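(* In the Markov modulated model for $n$ obligors described in the context, let $\zeta^k_s=\mathbf 1_{\{N_s=k\}}X_s$ for $0\le k\le n$, and $Q_{k\lambda}=Q-k\,\mathrm{diag}(\lambda)$ for $k\ge0$. For $0\le s\le t$ and $u\in\mathbb R$ the following hold: $$\mathbb E[e^{\mathrm iuN_t}X_t\mid\mathcal F_s]=\sum_{k=0}^n\sum_{j=k}^n\binom{n-k}{j-k}(1-e^{\mathrm iu})^{n-j}e^{\mathrm iuj}\exp\big(Q_{(n-j)\lambda}(t-s)\big)\zeta^k_s,$$ $$\mathbb E[e^{\mathrm iuN_t}\mid\mathcal F_s]=\sum_{k=0}^n\sum_{j=k}^n\binom{n-k}{j-k}(1-e^{\mathrm iu})^{n-j}e^{\mathrm iuj}\,\mathbf 1^\top\exp\big(Q_{(n-j)\lambda}(t-s)\big)\zeta^k_s,$$ where $\mathbf 1\in\mathbb R^d$ is the all-ones vector.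
   Context: Model. $X$ is a continuous-time Markov chain with values in the set $\{e_1,\dots,e_d\}$ of standard basis vectors of $\mathbb R^d$, with irreducible transition matrix $Q\in\mathbb R^{d\times d}$; convention: $Q_{ij}$, $i\neq j$, is the intensity of a transition from state $j$ to state $i$, so column sums of $Q$ are zero and $\mathrm dX_t=QX_t\,\mathrm dt+\mathrm dM^X_t$ with $M^X$ a martingale. Let $\lambda\in\mathbb R^d_+$. There are $n$ default times $\tau^1,\dots,\tau^n$ which, conditionally on the whole process $X$, are independent with $\mathbb P(\tau^i>t\mid\mathcal F^X)=\exp(-\int_0^t\lambda^\top X_s\,\mathrm ds)$. Put $Y^i_t=\mathbf 1_{\{\tau^i\le t\}}$ and $N_t=\sum_{i=1}^nY^i_t$ (so $N_0=0$). Then $\mathrm dN_t=\lambda^\top X_t(n-N_t)\,\mathrm dt+\mathrm dm_t$ with $m$ a martingale, and $X$ and $N$ have a.s. no simultaneous jumps. $(\mathcal F_t)$ is the filtration generated by $X$ and $Y^1,\dots,Y^n$. $\mathrm{diag}(\lambda)$ is the diagonal matrix with diagonal $\lambda$. *)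

(* Defs.v *)
From HB Require Import structures.
From mathcomp Require Import all_boot all_order all_algebra.
From mathcomp Require Import all_classical all_reals all_analysis.
From mathcomp Require Import measurable_realfun complex.

Set Implicit Arguments.
Unset Strict Implicit.
Unset Printing Implicit Defensive.

Import Order.TTheory GRing.Theory Num.Theory numFieldNormedType.Exports.

Local Open Scope classical_set_scope.
Local Open Scope ring_scope.

Definition mxexp (R : realType) (d : nat) (A : 'M[R]_d) : 'M[R]_d :=
  limn (series (fun m => (m`!%:R)^-1 *: A ^+ m)).

Definition cmx (R : realType) (m d : nat) (A : 'M[R]_(m, d)) : 'M[R[i]]_(m, d) :=
  map_mx (real_complex R) A.

(* e^{i x} *)
Definition expi (R : realType) (x : R) : R[i] := Complex (cos x) (sin x).

Section sigma_algebras_and_conditioning.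
Context (disp : measure_display) (T : measurableType disp) (R : realType).

(* Generating class of sigma(f i : i in J). *)
Definition preimages (I : Type) (J : set I) (f : I -> T -> R) : set_system T :=
  \bigcup_(i in J) preimage_set_system setT (f i) measurable.

(* [Z] is a version of E[Y | G], for a sub-sigma-algebra [G]. *)
Definition is_cond_exp (P : probability T R) (G : set_system T)
    (Y Z : T -> R) : Prop :=
  [/\ P.-integrable setT (EFin \o Y),
      P.-integrable setT (EFin \o Z),
      forall B : set R, measurable B -> G (Z @^-1` B) &
      forall A, G A ->
        (\int[P]_(w in A) (Y w)%:E = \int[P]_(w in A) (Z w)%:E)%E].

Definition is_cond_expC (P : probability T R) (G : set_system T)
    (Y Z : T -> R[i]) : Prop :=
  is_cond_exp P G (fun w => complex.Re (Y w)) (fun w => complex.Re (Z w)) /\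
  is_cond_exp P G (fun w => complex.Im (Y w)) (fun w => complex.Im (Z w)).

Definition is_cond_exp_vec (d : nat) (P : probability T R) (G : set_system T)
    (Y Z : T -> 'cV[R]_d) : Prop :=
  forall i, is_cond_exp P G (fun w => Y w i 0) (fun w => Z w i 0).

Definition is_cond_expC_vec (d : nat) (P : probability T R) (G : set_system T)
    (Y Z : T -> 'cV[R[i]]_d) : Prop :=
  forall i, is_cond_expC P G (fun w => Y w i 0) (fun w => Z w i 0).

(* Conditional independence of [tau 0], ..., [tau n.-1] given [G]: the product
   rule for arbitrary Borel sets, for any versions of the conditional
   probabilities (subfamilies are covered by taking some [B i := setT]). *)
Definition cond_independent (n : nat) (P : probability T R) (G : set_system T)
    (tau : 'I_n -> T -> \bar R) : Prop :=
  forall (B : 'I_n -> set (\bar R)) (p : 'I_n -> T -> R),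
    (forall i, measurable (B i)) ->
    (forall i, is_cond_exp P G \1_(tau i @^-1` B i) (p i)) ->
    is_cond_exp P G \1_[set w | forall i, B i (tau i w)]
      (fun w => \prod_(i < n) p i w).

End sigma_algebras_and_conditioning.

Section transition_matrix.
Context (R : realType) (d : nat).

(* Column convention: [Q i j] is the intensity of a jump from [j] to [i]. *)
Definition intensity_matrix (Q : 'M[R]_d) : Prop :=
  (forall i j, i != j -> 0 <= Q i j) /\ (forall j, \sum_(i < d) Q i j = 0).

Definition irreducible_intensity (Q : 'M[R]_d) : Prop :=
  forall j i : 'I_d, connect (fun a b : 'I_d => 0 < Q b a) j i.

Definition transition_semigroup (p : R -> 'M[R]_d) : Prop :=
  [/\ p 0 = 1%:M,
      forall s t, 0 <= s -> 0 <= t -> p (s + t) = p s *m p t,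
      forall t i j, 0 <= t -> 0 <= p t i j &
      forall t j, 0 <= t -> \sum_(i < d) p t i j = 1].

End transition_matrix.

Section model.
Context (disp : measure_display) (T : measurableType disp) (R : realType).
Context (d n : nat).
Implicit Types (X : R -> T -> 'cV[R]_d) (tau : 'I_n -> T -> \bar R).

Definition preimagesX X (D : set R) : set_system T :=
  preimages [set ri : R * 'I_d | D ri.1] (fun ri w => X ri.1 w ri.2 0).

(* F^X_s *)
Definition filtrationX X (s : R) : set_system T := <<s preimagesX X `[0, s] >>.

(* F^X, generated by the whole process *)
Definition sigmaX X : set_system T := <<s preimagesX X `[0, +oo[ >>.

(* Only times [t >= 0] matter. As [X t] takes its values in the standard basis,
   E[X_{s+h} | F^X_s] is the vector of conditional probabilities
   P(X_{s+h} = e_i | F^X_s), so the last clause says that [X] is a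
   time-homogeneous Markov chain whose transition probabilities
   [p h i j] = P(X_{s+h} = e_i | X_s = e_j) have intensities [Q] = p'(0+). *)
Definition markov_chain (P : probability T R) X (Q : 'M[R]_d) : Prop :=
  [/\ forall t w, 0 <= t -> exists i : 'I_d, X t w = delta_mx i 0,
      forall t (i : 'I_d), 0 <= t -> measurable_fun setT (fun w => X t w i 0),
      forall t w, 0 <= t -> X r w @[r --> t^'+] --> X t w,
      forall t w, 0 < t -> cvg (X r w @[r --> t^'-]) &
      exists p : R -> 'M[R]_d,
        [/\ transition_semigroup p,
            h^-1 *: (p h - 1%:M) @[h --> 0^'+] --> Q &
            forall s h, 0 <= s -> 0 <= h ->
              is_cond_exp_vec P (filtrationX X s)
                (X (s + h)) (fun w => p h *m X s w)]].

Definition cumulative_hazard X (lambda : 'cV[R]_d) (t : R) (w : T) : R :=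
  \int[lebesgue_measure]_(s in `[0, t]) (lambda^T *m X s w) 0 0.

(* The default times may be infinite. *)
Definition default_times (P : probability T R) X (lambda : 'cV[R]_d) tau : Prop :=
  [/\ forall i, measurable_fun setT (tau i),
      forall i w, (0 <= tau i w)%E,
      cond_independent P (sigmaX X) tau &
      forall i t, 0 <= t ->
        is_cond_exp P (sigmaX X) \1_[set w | (t%:E < tau i w)%E]
          (fun w => expR (- cumulative_hazard X lambda t w))].

Definition default_indicator tau (i : 'I_n) (t : R) (w : T) : nat :=
  (tau i w <= t%:E)%E.

Definition default_count tau (t : R) (w : T) : nat :=
  \sum_(i < n) default_indicator tau i t w.

(* F_s, generated by X and Y^1, ..., Y^n up to time s *)
Definition filtration X tau (s : R) : set_system T :=
  <<s preimagesX X `[0, s] `|`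
      preimages [set ri : R * 'I_n | 0 <= ri.1 <= s]
        (fun ri w => (default_indicator tau ri.2 ri.1 w)%:R : R) >>.

Definition zeta X tau (k : nat) (s : R) (w : T) : 'cV[R]_d :=
  (default_count tau s w == k)%:R *: X s w.

Definition killed_intensity (Q : 'M[R]_d) (lambda : 'cV[R]_d) (k : nat) : 'M[R]_d :=
  Q - k%:R *: diag_mx lambda^T.

End model.

(* Main.v *)
Require Import Defs.
From HB Require Import structures.
From mathcomp Require Import all_boot all_order all_algebra.
From mathcomp Require Import all_classical all_reals all_analysis.
From mathcomp Require Import measurable_realfun complex.
From mathcomp Require Import ring lra.

Set Implicit Arguments.
Unset Strict Implicit.
Unset Printing Implicit Defensive.

Import Order.TTheory GRing.Theory Num.Theory numFieldNormedType.Exports.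
Local Open Scope ring_scope.
Local Open Scope classical_set_scope.

(** With [z = e^{iu}], the product
    [e^{iu N_t} = \prod_k (z + (1 - z) 1_{tau^k > t})] expands over the sets [K] of
    obligors into survival indicators.  The right-hand side of the theorem expands
    in the same way, so it suffices to prove, for every [K],
      [E[1_{tau^k > t, k in K} X_t | F_s]
         = 1_{tau^k > s, k in K} exp (Q_{|K| lambda} (t - s)) X_s].
    [F_s] is generated by the pi-system of the events
    [B /\ {tau^k > r_k for all k}] with [B] in [F^X_s] and [r_k <= s].  On such an
    event conditional independence turns each survival indicator into
    [exp (- Lambda)], where [Lambda] is the cumulative hazard, and what remains is
    the Feynman-Kac formula
      [E[W exp (- m (Lambda_t - Lambda_s)) X_t] = exp (Q_{m lambda} (t - s)) E[W X_s]]
    for [W] measurable with respect to [F^X_s].  By right continuity of the paths,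
    [Lambda_t - Lambda_s] is the limit of its Riemann sums at right end points.
    Iterating the Markov property along a grid of mesh [h / N], [h = t - s], turns
    the discretized left-hand side into
    [(exp (- m h / N diag lambda) p_{h/N})^N E[W X_s]], and this power converges
    to the matrix exponential because its factor is
    [1 + Q_{m lambda} h / N + o(1 / N)] and is column-substochastic. *)

(** * Powers of matrices close to the identity *)

Section matrix_exponential.
Context (R : realType) (d : nat).
Implicit Types (A B C : 'M[R]_d) (a b c e : R).

(** An upper bound for the operator norm induced by the l1 norm on column vectors. As a predicate it
    needs no maximum over a possibly empty index set. Matrices that are substochastic in the column
    convention satisfy it with [c = 1]. *)
Definition colsum_le A c := forall j, \sum_i `|A i j| <= c.

Lemma colsum_leW A a b : a <= b -> colsum_le A a -> colsum_le A b.
Proof. by move=> ab Aa j; exact: le_trans (Aa j) ab. Qed.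

Lemma colsum_le_total A : colsum_le A (\sum_j \sum_i `|A i j|).
Proof.
move=> j; rewrite [leRHS](bigD1 j)//= lerDl.
by apply: sumr_ge0 => k _; apply: sumr_ge0.
Qed.

Lemma colsum_le_entry A c i j : colsum_le A c -> `|A i j| <= c.
Proof.
by move=> /(_ j); apply: le_trans; rewrite (bigD1 i)//= lerDl sumr_ge0.
Qed.

Lemma colsum_le1 : colsum_le 1 1.
Proof.
move=> j; rewrite (bigD1 j)//= mxE eqxx normr1 big1 ?addr0// => i ij.
by rewrite mxE (negPf ij) normr0.
Qed.

Lemma colsum_leD A B a b :
  colsum_le A a -> colsum_le B b -> colsum_le (A + B) (a + b).
Proof.
move=> Aa Bb j; apply: le_trans (lerD (Aa j) (Bb j)).
by rewrite -big_split ler_sum// => i _; rewrite mxE ler_normD.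
Qed.

Lemma colsum_leZ r A a : colsum_le A a -> colsum_le (r *: A) (`|r| * a).
Proof.
move=> Aa j; under eq_bigr do rewrite mxE normrM.
by rewrite -mulr_sumr ler_wpM2l.
Qed.

Lemma colsum_leM A B a b :
  colsum_le A a -> colsum_le B b -> colsum_le (A * B) (a * b).
Proof.
move=> Aa Bb j.
have a0 : 0 <= a by apply: le_trans (Aa j); exact: sumr_ge0.
apply: (@le_trans _ _ (\sum_i \sum_k `|A i k| * `|B k j|)).
  apply: ler_sum => i _; rewrite mxE (le_trans (ler_norm_sum _ _ _))//.
  by apply: ler_sum => k _; rewrite normrM.
rewrite exchange_big /=; under eq_bigr do rewrite -mulr_suml.
apply: (@le_trans _ _ (\sum_k a * `|B k j|)).
  by apply: ler_sum => k _; exact: ler_wpM2r.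
by rewrite -mulr_sumr ler_wpM2l.
Qed.

Lemma colsum_leX A a n : colsum_le A a -> colsum_le (A ^+ n) (a ^+ n).
Proof.
move=> Aa; elim: n => [|n IH]; first exact: colsum_le1.
by rewrite !exprS; exact: colsum_leM.
Qed.

Lemma colsum_le_sum n (F : nat -> 'M[R]_d) (f : nat -> R) :
  (forall k, (k < n)%N -> colsum_le (F k) (f k)) ->
  colsum_le (\sum_(k < n) F k) (\sum_(k < n) f k).
Proof.
elim: n => [|n IH] Ff.
  by move=> j; rewrite !big_ord0 big1// => i _; rewrite mxE normr0.
rewrite !big_ord_recr/=; apply: colsum_leD; last exact: Ff.
by apply: IH => k kn; apply: Ff; exact: ltnW.
Qed.

(** Telescoping: [A ^+ n.+1 - B ^+ n.+1 = A * (A ^+ n - B ^+ n) + (A - B) * B ^+ n]. Since [1 <= a],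
    the factor [a ^+ n] of the second term may be enlarged to [a ^+ n.+1]. *)
Lemma colsum_le_subX A B a e n : 1 <= a ->
  colsum_le A a -> colsum_le B a -> colsum_le (A - B) e ->
  colsum_le (A ^+ n - B ^+ n) (n%:R * e * a ^+ n).
Proof.
move=> a1 Aa Ba ABe; elim: n => [|n IH].
  by rewrite !expr0 subrr !mul0r => j; rewrite big1// => i _; rewrite mxE normr0.
rewrite (_ : _ - _ = A * (A ^+ n - B ^+ n) + (A - B) * B ^+ n); last first.
  by rewrite mulrBr mulrBl -!exprS addrA subrK.
move=> j.
have e0 : 0 <= e by apply: le_trans (ABe j); exact: sumr_ge0.
have /(_ j) := colsum_leD (colsum_leM Aa IH) (colsum_leM ABe (colsum_leX n Ba)).
move=> /le_trans; apply.
rewrite -natr1 mulrDl mulrDl mul1r lerD//; first by rewrite exprS mulrCA.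
by rewrite ler_wpM2l// exprS ler_peMl// exprn_ge0// (le_trans _ a1).
Qed.

Lemma bernoulli_ineq (x : R) n : 0 <= x <= 1 -> 1 - n%:R * x <= (1 - x) ^+ n.
Proof.
move=> /andP[x0 x1]; elim: n => [|n IH]; first by rewrite mul0r subr0 expr0.
rewrite exprS; have : (1 - x) * (1 - n%:R * x) <= (1 - x) * (1 - x) ^+ n.
  by rewrite ler_wpM2l// subr_ge0.
apply: le_trans; rewrite -natr1.
have : 0 <= n%:R * x * x by rewrite !mulr_ge0.
by set y := n%:R; nra.
Qed.

(* [(1 + x) e^{-x} >= 1 - x^2], raised to the power n by Bernoulli's
   inequality. *)
Lemma compound_expR_ge (c : R) n : 0 <= c -> c <= n.+1%:R ->
  expR c * (1 - c ^+ 2 / n.+1%:R) <= (1 + c / n.+1%:R) ^+ n.+1.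
Proof.
move=> c0 cn; set N : R := n.+1%:R; pose x := c / N.
have N0 : 0 < N by rewrite ltr0n.
have x0 : 0 <= x by rewrite divr_ge0// ltW.
have x1 : x <= 1 by rewrite ler_pdivrMr// mul1r.
have cE : expR c = expR x ^+ n.+1 by rewrite -expRM_natl mulrC divfK// gt_eqF.
have -> : c ^+ 2 / N = N * x ^+ 2.
  by rewrite /x; field; rewrite gt_eqF.
have /(@bernoulli_ineq _ n.+1) : 0 <= x ^+ 2 <= 1.
  by rewrite exprn_ge0//= exprn_ile1.
move=> /(ler_wpM2l (expR_ge0 c))/le_trans; apply.
rewrite cE -exprMn lerXn2r ?nnegrE//.
- by rewrite mulr_ge0 ?expR_ge0// subr_ge0 exprn_ile1.
- by rewrite addr_ge0.
have := expR_ge1Dx (- x); rewrite expRN => h.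
have e0 := expR_gt0 x.
rewrite (_ : 1 - x ^+ 2 = (1 + x) * (1 - x)); last by ring.
rewrite mulrCA ler_piMr ?addr_ge0//.
by rewrite mulrC -ler_pdivlMr// div1r.
Qed.

Lemma ffact_le_exp n k : (n ^_ k <= n ^ k)%N.
Proof.
elim: k => [//|k IH]; rewrite ffactnSr expnSr.
by apply: leq_mul => //; exact: leq_subr.
Qed.

(** Coefficientwise, the expansion of [(1 + x / n.+1) ^+ n.+1] is dominated by the exponential
    series, so the difference of the two has nonnegative coefficients. *)
Lemma bin_div_exp_le n k :
  'C(n.+1, k)%:R / n.+1%:R ^+ k <= k`!%:R^-1 :> R.
Proof.
rewrite ler_pdivrMr ?exprn_gt0// mulrC ler_pdivlMr ?ltr0n ?fact_gt0//.
by rewrite -natrM -natrX ler_nat bin_ffact ffact_le_exp.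
Qed.

Lemma exprZmx r A n : (r *: A) ^+ n = r ^+ n *: A ^+ n.
Proof.
elim: n => [|n IH]; first by rewrite !expr0 scale1r.
rewrite !exprS IH -[LHS]/(_ *m _) -scalemxAl -scalemxAr scalerA.
by rewrite -exprS.
Qed.

Lemma compound_expandE C n :
  (1 + n.+1%:R^-1 *: C) ^+ n.+1 =
  \sum_(k < n.+2) ('C(n.+1, k)%:R / n.+1%:R ^+ k) *: C ^+ k.
Proof.
rewrite addrC exprDn_comm; last exact: commr1.
rewrite (reindex_inj rev_ord_inj) /=; apply: eq_bigr => k _.
have kn : (k <= n.+1)%N by rewrite -ltnS.
rewrite subSS (subKn kn) expr1n mulr1 (bin_sub kn).
by rewrite -scaler_nat exprZmx scalerA exprVn.
Qed.

(** The difference is a polynomial in [C] with nonnegative coefficients, so its norm is at most the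
    same polynomial at [c]. That scalar is a partial sum of [expR c] minus [(1 + c / n.+1) ^+ n.+1],
    which [compound_expR_ge] controls. *)
Lemma colsum_le_compound C c n : colsum_le C c -> 0 <= c <= n.+1%:R ->
  colsum_le (series (fun m => (m`!%:R)^-1 *: C ^+ m) n.+2
             - (1 + n.+1%:R^-1 *: C) ^+ n.+1)
            (expR c * (c ^+ 2 / n.+1%:R)).
Proof.
move=> Cc /andP[c0 cn]; rewrite compound_expandE /series/= big_mkord -sumrB.
under eq_bigr do rewrite -scalerBl.
apply: (@colsum_leW _ (\sum_(k < n.+2)
   (k`!%:R^-1 - 'C(n.+1, k)%:R / n.+1%:R ^+ k) * c ^+ k)); last first.
  apply: (colsum_le_sum
    (F := fun k => (k`!%:R^-1 - 'C(n.+1, k)%:R / n.+1%:R ^+ k) *: C ^+ k)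
    (f := fun k => (k`!%:R^-1 - 'C(n.+1, k)%:R / n.+1%:R ^+ k) * c ^+ k)).
  move=> k _; rewrite -[X in colsum_le _ (X * _)]ger0_norm.
    by apply: colsum_leZ; exact: colsum_leX.
  by rewrite subr_ge0 bin_div_exp_le.
under eq_bigr do rewrite mulrBl.
rewrite sumrB (_ : \sum_(k < n.+2) _ * _ = series (exp_coeff c) n.+2); last first.
  by rewrite /series/= big_mkord; apply: eq_bigr => k _; rewrite exp_coeffE.
have -> : \sum_(i < n.+2) 'C(n.+1, i)%:R / n.+1%:R ^+ i * c ^+ i =
    (1 + c / n.+1%:R) ^+ n.+1.
  rewrite addrC exprDn [RHS](reindex_inj rev_ord_inj) /=; apply: eq_bigr => k _.
  have kn : (k <= n.+1)%N by rewrite -ltnS.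
  rewrite subSS (subKn kn) expr1n mulr1 (bin_sub kn).
  by rewrite expr_div_n -mulr_natl; ring.
have h := compound_expR_ge c0 cn.
have : series (exp_coeff c) n.+2 <= expR c.
  apply: nondecreasing_cvgn_le; last exact: is_cvg_series_exp_coeff.
  by apply/nondecreasing_series => k _ _; exact: exp_coeff_ge0.
move: h; rewrite mulrBr mulr1 !lerBlDl => h /le_trans; apply.
by rewrite addrC.
Qed.

Lemma colsum_le_ge0 A c (j : 'I_d) : colsum_le A c -> 0 <= c.
Proof. by move=> /(_ j); apply: le_trans; exact: sumr_ge0. Qed.

Lemma cvg_mxP (A : nat -> 'M[R]_d) B :
  A @ \oo --> B <-> forall i j, A n i j @[n --> \oo] --> B i j.
Proof.
split => [AB i j|AB].
  exact: (cvg_comp _ _ AB (@coord_continuous _ _ _ i j B)).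
move=> P [Q BQ QP]; have : \forall n \near \oo, forall i j, Q i j (A n i j).
  apply: filter_forall => i; apply: filter_forall => j.
  exact: AB i j _ (BQ i j).
by apply: filterS => n; exact: QP.
Qed.

(** [mxexp] is defined as a [limn], which has meaning only once convergence is known. Each entry
    converges absolutely by comparison with the scalar exponential series at [c], the sum of all
    absolute entries of [C]. *)
Lemma mxexp_cvg C i j :
  series (fun m => (m`!%:R)^-1 *: C ^+ m) n i j @[n --> \oo] --> mxexp C i j.
Proof.
suff : cvgn (series (fun m => (m`!%:R)^-1 *: C ^+ m)).
  by move=> h; exact: (cvg_mxP _ _).1 h i j.
apply/cvg_ex.
pose u (a b : 'I_d) m := m`!%:R^-1 * (C ^+ m) a b.
have us (a b : 'I_d) n :
    series (fun m => (m`!%:R)^-1 *: C ^+ m) n a b = series (u a b) n.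
  by rewrite /series/= summxE; apply: eq_bigr => k _; rewrite mxE.
exists (\matrix_(a, b) limn (series (u a b))); apply/cvg_mxP => a b.
rewrite mxE; under eq_cvg do rewrite us.
apply: normed_cvg; pose c : R := \sum_j \sum_i `|C i j|.
have Cc := colsum_le_total C; rewrite -/c in Cc.
have c0 := colsum_le_ge0 a Cc.
apply: (series_le_cvg (v_ := exp_coeff c)) => [n|n|n|].
- exact: normr_ge0.
- exact: exp_coeff_ge0.
- rewrite exp_coeffE /= /u normrM ger0_norm ?invr_ge0// ler_wpM2l ?invr_ge0//.
  exact/colsum_le_entry/colsum_leX.
- exact: is_cvg_series_exp_coeff.
Qed.

Lemma mxexp_limit (A : nat -> 'M[R]_d) C : (forall n, colsum_le (A n) 1) ->
  (forall i j, n.+1%:R * (A n - 1) i j @[n --> \oo] --> C i j) ->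
  forall i j, (A n ^+ n.+1) i j @[n --> \oo] --> mxexp C i j.
Proof.
move=> A1 AC i j.
pose c : R := \sum_j \sum_i `|C i j|.
have Cc := colsum_le_total C; rewrite -/c in Cc.
have c0 := colsum_le_ge0 i Cc.
pose e n : R := \sum_j \sum_i `|(n.+1%:R *: (A n - 1) - C) i j|.
(* The [n.+2] terms reach degree [n.+1], the degree of the power being approximated. *)
pose S n : 'M[R]_d := series (fun m => (m`!%:R)^-1 *: C ^+ m) n.+2.
have e0 : e n @[n --> \oo] --> 0.
  rewrite [X in _ --> X](_ : 0 = \sum_(j < d) \sum_(i < d) `|(0 : R)|); last first.
    by rewrite big1// => a _; rewrite big1// normr0.
  apply: cvg_big => [|b _]; first exact: add_continuous.
  apply: cvg_big => [|a _]; first exact: add_continuous.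
  apply: cvg_norm.
  rewrite (_ : (fun n => _) = fun n => n.+1%:R * (A n - 1) a b - C a b); last first.
    by apply/funext => n; rewrite !mxE.
  by rewrite -(subrr (C a b)); apply: cvgB; [exact: AC|exact: cvg_cst].
have bound n : c <= n.+1%:R ->
    `|(A n ^+ n.+1) i j - S n i j| <=
    e n * expR c + expR c * (c ^+ 2 / n.+1%:R).
  move=> cn; pose B := 1 + n.+1%:R^-1 *: C.
  have n0 : 0 < n.+1%:R :> R by rewrite ltr0n.
  have B1 : colsum_le B (1 + c / n.+1%:R).
    apply: colsum_leD; first exact: colsum_le1.
    have := colsum_leZ n.+1%:R^-1 Cc.
    by rewrite ger0_norm ?invr_ge0// mulrC.
  have AB : colsum_le (A n - B) (e n / n.+1%:R).
    have := colsum_leZ n.+1%:R^-1 (colsum_le_total (n.+1%:R *: (A n - 1) - C)).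
    rewrite scalerBr scalerA mulVf ?gt_eqF// scale1r ger0_norm ?invr_ge0//.
    by rewrite mulrC opprD addrA.
  have ge1 : 1 <= 1 + c / n.+1%:R by rewrite lerDl divr_ge0.
  have h1 := colsum_le_subX n.+1 ge1 (colsum_leW ge1 (A1 n)) B1 AB.
  have h2 := colsum_le_compound Cc; have {}h2 := h2 n _.
  have {}h2 : colsum_le (S n - B ^+ n.+1) (expR c * (c ^+ 2 / n.+1%:R)).
    by apply: h2; rewrite c0.
  have /(colsum_le_entry i j) := colsum_leZ (-1) h2.
  have /(colsum_le_entry i j) := h1.
  rewrite normrN1 mul1r scaleN1r opprB => k1 k2.
  rewrite (_ : _ - _ =
    (A n ^+ n.+1 - B ^+ n.+1) i j + (B ^+ n.+1 - S n) i j); last first.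
    by rewrite !mxE addrA subrK.
  apply: le_trans (ler_normD _ _) _; apply: lerD => //.
  apply: le_trans k1 _; rewrite mulrCA mulfV ?gt_eqF// mulr1.
  have en0 : 0 <= e n by apply: sumr_ge0 => a _; exact: sumr_ge0.
  rewrite ler_wpM2l//.
  rewrite (_ : expR c = expR (c / n.+1%:R) ^+ n.+1); last first.
    by rewrite -expRM_natl mulrC divfK// gt_eqF.
  by rewrite lerXn2r ?nnegrE ?(le_trans _ ge1)// ?expR_ge0// expR_ge1Dx.
have AS : (A n ^+ n.+1) i j - S n i j @[n --> \oo] --> 0.
  apply: norm_cvg0; apply: (@squeeze_cvgr _ _ _ _ (cst 0)
     (fun n => e n * expR c + expR c * (c ^+ 2 / n.+1%:R))).
  - near=> n; rewrite normr_ge0/=; apply: bound.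
    near: n; exists (Num.truncn c) => // m /= cm; apply/ltW.
    by rewrite -truncn_le_nat.
  - exact: cvg_cst.
  - rewrite -[X in _ --> X]addr0 -[X in _ --> X + _](mul0r (expR c)).
    apply: cvgD; first exact: cvgMr_tmp.
    rewrite -[X in _ --> X](mulr0 (expR c)); apply: cvgMl_tmp.
    rewrite -[X in _ --> X](mulr0 (c ^+ 2)); apply: cvgMl_tmp.
    exact: cvg_harmonic.
have Sm : S n i j @[n --> \oo] --> mxexp C i j.
  have := @mxexp_cvg C i j; rewrite -(cvg_shiftn 2).
  by apply: cvg_trans; apply: near_eq_cvg; near=> n; rewrite /S/= addn2.
rewrite -[X in _ --> X]add0r; apply: cvg_trans (cvgD AS Sm).
by apply: near_eq_cvg; near=> n; rewrite /= fctE subrK.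
Unshelve. all: by end_near. Qed.

End matrix_exponential.

(** * Conditional expectation *)

Section real_integrals.
Context d (T : measurableType d) (R : realType) (mu : {measure set T -> \bar R}).

Lemma Rintegral_sum (D : set T) I (s : seq I) (f : I -> T -> R) : measurable D ->
  (forall i, mu.-integrable D (EFin \o f i)) ->
  \int[mu]_(x in D) (\sum_(i <- s) f i x) = \sum_(i <- s) \int[mu]_(x in D) f i x.
Proof.
move=> mD fi; elim: s => [|i s IH].
  rewrite big_nil; under eq_Rintegral do rewrite big_nil.
  by rewrite Rintegral_cst// mul0r.
rewrite big_cons -IH -RintegralD//.
  by apply: eq_Rintegral => x _; rewrite big_cons.
rewrite (_ : _ \o _ = (fun x => \sum_(j <- s) (f j x)%:E)%E).
  by apply: integrable_sum => // j _; exact: fi.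
by apply/funext => x /=; rewrite sumEFin.
Qed.

Lemma Rintegral_cvg (D : set T) (f_ : (T -> R)^nat) (f g : T -> R) :
  measurable D -> (forall n, measurable_fun D (f_ n)) ->
  (forall x, D x -> f_ n x @[n --> \oo] --> f x) ->
  mu.-integrable D (EFin \o g) ->
  (forall n x, D x -> `|f_ n x| <= g x) ->
  \int[mu]_(x in D) f_ n x @[n --> \oo] --> \int[mu]_(x in D) f x.
Proof.
move=> mD mf_ f_f ig f_g.
have [|||||inf _ h] := @dominated_convergence _ _ _ mu D mD
    (fun n => EFin \o f_ n) (EFin \o f) (EFin \o g).
- by move=> n; exact/measurable_EFinP.
- by apply/measurable_EFinP/(measurable_fun_cvg mf_).
- by apply: aeW => x Dx; by apply/fine_cvgP; split; [exact: nearW|exact: f_f].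
- exact: ig.
- by apply: aeW => x n Dx /=; rewrite lee_fin f_g.
apply/fine_cvg; rewrite fineK; first exact: h.
exact: integrable_fin_num.
Qed.

End real_integrals.

(** * Functions measurable with respect to a sub-sigma-algebra *)

Section sub_sigma_algebra.
Context d (T : measurableType d) (R : realType).
Implicit Types (G : set_system T) (f g : T -> R).

(** This is the measurability clause of [is_cond_exp]. For a generated sigma-algebra, [smeasurableP]
    identifies it with [measurable_fun] on [g_sigma_algebraType], from which the closure properties
    are inherited. *)
Definition smeasurable G f := forall B : set R, measurable B -> G (f @^-1` B).

Lemma smeasurableS G G' f : G `<=` G' -> smeasurable G f -> smeasurable G' f.
Proof. by move=> GG' Gf B mB; apply: GG'; exact: Gf. Qed.

Lemma smeasurableP G f :
  smeasurable <<s G >> f <->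
  measurable_fun [set: g_sigma_algebraType G] (f : g_sigma_algebraType G -> R).
Proof.
split => [Gf _ B mB|mf B mB]; first by rewrite setTI; exact: Gf.
by rewrite -[X in smallest _ _ X]setTI; exact: mf.
Qed.

Lemma smeasurable_measurable G f : G `<=` measurable ->
  smeasurable G f -> measurable_fun [set: T] f.
Proof. by move=> Gm Gf _ B mB; rewrite setTI; apply: Gm; exact: Gf. Qed.

Lemma smeasurableM G f g :
  smeasurable <<s G >> f -> smeasurable <<s G >> g ->
  smeasurable <<s G >> (f \* g).
Proof.
by move=> /smeasurableP mf /smeasurableP mg; apply/smeasurableP/measurable_funM.
Qed.

Lemma smeasurableD G f g :
  smeasurable <<s G >> f -> smeasurable <<s G >> g ->
  smeasurable <<s G >> (f \+ g).
Proof.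
by move=> /smeasurableP mf /smeasurableP mg; apply/smeasurableP/measurable_funD.
Qed.

Lemma smeasurable_cst G (r : R) : smeasurable <<s G >> (cst r).
Proof. by apply/smeasurableP. Qed.

Lemma smeasurable_sum G I (s : seq I) (h : I -> T -> R) :
  (forall i, smeasurable <<s G >> (h i)) ->
  smeasurable <<s G >> (fun x => \sum_(i <- s) h i x).
Proof. by move=> mh; apply/smeasurableP/measurable_sum => i; apply/smeasurableP. Qed.

Lemma smeasurable_prod G (I : eqType) (s : seq I) (h : I -> T -> R) :
  (forall i, smeasurable <<s G >> (h i)) ->
  smeasurable <<s G >> (fun x => \prod_(i <- s) h i x).
Proof.
by move=> mh; apply/smeasurableP/measurable_prod => i _; apply/smeasurableP.
Qed.

Lemma smeasurable_comp G (h : R -> R) f : measurable_fun setT h ->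
  smeasurable G f -> smeasurable G (h \o f).
Proof.
move=> mh Gf B mB; rewrite comp_preimage; apply: Gf.
rewrite -[X in measurable X]setTI; exact: mh.
Qed.

Lemma smeasurable_cvg G (f_ : (T -> R)^nat) f :
  (forall n, smeasurable <<s G >> (f_ n)) ->
  (forall x, f_ n x @[n --> \oo] --> f x) -> smeasurable <<s G >> f.
Proof.
move=> mf_ f_f; apply/smeasurableP.
apply: (@measurable_fun_cvg _ (g_sigma_algebraType G) R setT f_).
  by move=> n; exact/smeasurableP.
by move=> x _; exact: f_f.
Qed.

Lemma smeasurable_indic G (A : set T) : <<s G >> A ->
  smeasurable <<s G >> (\1_A : T -> R).
Proof. by move=> GA; apply/smeasurableP/measurable_indic. Qed.

End sub_sigma_algebra.

(** * Conditional expectations: weights and linearity *)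

Section cond_exp.
Context d (T : measurableType d) (R : realType) (P : probability T R).
Implicit Types (G : set_system T) (Y Z W f : T -> R).

Lemma bounded_integrable (D : set T) f M : measurable D -> measurable_fun D f ->
  (forall w, D w -> `|f w| <= M) -> P.-integrable D (EFin \o f).
Proof.
move=> mD mf fM; apply: measurable_bounded_integrable => //.
  by rewrite (le_lt_trans (probability_le1 P mD))// ltry.
exists M; split; first exact: num_real.
by move=> x Mx w Dw; apply: le_trans (fM w Dw) (ltW Mx).
Qed.

Lemma bounded_mul_integrable W M f : measurable_fun setT W ->
  (forall w, `|W w| <= M) -> P.-integrable setT (EFin \o f) ->
  P.-integrable setT (EFin \o (W \* f)).
Proof.
move=> mW WM fi.
have fm : measurable_fun setT f by apply/measurable_EFinP/measurable_int/fi.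
apply: (@le_integrable _ _ _ _ _ measurableT _ (fun w => (M * f w)%:E)).
- exact/measurable_EFinP/measurable_funM.
- move=> w _; rewrite lee_fin !normrM ler_wpM2r//.
  by apply: le_trans (WM w) _; exact: ler_norm.
- exact: (integrableZl measurableT M fi).
Qed.

Lemma Rintegral_indicM (A : set T) f :
  \int[P]_w (\1_A w * f w) = \int[P]_(w in A) f w.
Proof.
rewrite [RHS]Rintegral_mkcond; apply: eq_Rintegral => w _.
by rewrite patchE indicE; case: ifP => _; rewrite ?mul1r ?mul0r.
Qed.

Lemma is_cond_exp_Rintegral G Y Z A : is_cond_exp P G Y Z -> G A ->
  \int[P]_(w in A) Y w = \int[P]_(w in A) Z w.
Proof. by move=> [_ _ _ h] GA; rewrite /Rintegral h. Qed.

(** Integrability makes the extended-real integrals finite, so their equality can be checked on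
    real-valued integrals. *)
Lemma is_cond_expP G Y Z : G `<=` measurable ->
  P.-integrable setT (EFin \o Y) -> P.-integrable setT (EFin \o Z) ->
  smeasurable G Z ->
  (forall A, G A -> \int[P]_(w in A) Y w = \int[P]_(w in A) Z w) ->
  is_cond_exp P G Y Z.
Proof.
move=> Gm Yi Zi mZ h; split => // A GA; have mA := Gm _ GA.
have fin f : P.-integrable setT (EFin \o f) ->
    (\int[P]_(w in A) (f w)%:E)%E = (\int[P]_(w in A) f w)%:E.
  move=> fi; rewrite /Rintegral fineK//; apply: integrable_fin_num => //.
  exact: integrableS fi.
by rewrite !fin// h.
Qed.

(* The sum is the floor of [n.+1%:R * x]. *)
Lemma discretization_bound (x : R) n : 0 <= x <= 1 ->
  `|n.+1%:R^-1 * \sum_(j < n.+1) (j.+1%:R <= n.+1%:R * x)%R%:R - x| <= n.+1%:R^-1.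
Proof.
move=> /andP[x0 x1]; set N : R := n.+1%:R.
have N0 : 0 < N by rewrite ltr0n.
have Nx0 : 0 <= N * x by rewrite mulr_ge0// ltW.
have -> : \sum_(j < n.+1) (j.+1%:R <= N * x)%R%:R = (Num.truncn (N * x))%:R :> R.
  rewrite -natr_sum; congr (_%:R).
  have trn : (Num.truncn (N * x) <= n.+1)%N.
    rewrite truncn_le_nat (@le_lt_trans _ _ N)//; last by rewrite ltr_nat.
    by rewrite ler_piMr// ltW.
  transitivity (\sum_(j < n.+1) (j < Num.truncn (N * x))%N)%N.
    apply: eq_bigr => j _; congr nat_of_bool.
    by rewrite truncn_gt_nat.
  rewrite (eq_bigr (fun j : 'I_n.+1 =>
    if (j < Num.truncn (N * x))%N then 1%N else 0%N)); last first.
    by move=> j _; case: ltnP.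
  by rewrite -big_mkcond (big_ord_narrow trn) sum1_card card_ord.
have /andP[t1 t2] := truncn_itv Nx0.
rewrite -(ler_pM2l N0) mulfV ?gt_eqF// -{1}(gtr0_norm N0) -normrM.
rewrite mulrBr mulrA mulfV ?gt_eqF// mul1r distrC ger0_norm ?subr_ge0//.
by rewrite lerBlDl natr1 ltW.
Qed.

(** The defining identity is passed from events to weights. The floor of [n.+1 * W], divided by
    [n.+1], is an average of indicators of the level sets [A n j] and tends uniformly to [W];
    dominated convergence concludes. *)
Lemma cond_exp_weight (G : set_system T) Y Z W : <<s G >> `<=` measurable ->
  is_cond_exp P <<s G >> Y Z -> smeasurable <<s G >> W ->
  (forall w, 0 <= W w <= 1) ->
  \int[P]_w (W w * Y w) = \int[P]_w (W w * Z w).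
Proof.
move=> Gm YZ mW W01.
have [Yi Zi _ _] := YZ.
pose A n (j : 'I_n.+1) := [set w | j.+1%:R <= n.+1%:R * W w].
have GA n j : <<s G >> (A n j).
  have := @smeasurableM _ _ _ G _ _ (smeasurable_cst (G := G) n.+1%:R) mW.
  move=> /(_ `[j.+1%:R, +oo[%classic (measurable_itv _)).
  rewrite (_ : _ @^-1` _ = A n j)//.
  by apply/seteqP; split => w /=; rewrite in_itv/= andbT.
pose V n w := n.+1%:R^-1 * \sum_(j < n.+1) \1_(A n j) w : R.
have VE n w : V n w = n.+1%:R^-1 * \sum_(j < n.+1) (j.+1%:R <= n.+1%:R * W w)%R%:R.
  congr (_ * _); apply: eq_bigr => j _; rewrite indicE; congr (nat_of_bool _)%:R.
  by apply/idP/idP => [/set_mem//|h]; exact/mem_set.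
have VW n w : `|V n w - W w| <= n.+1%:R^-1 by rewrite VE; exact: discretization_bound.
have Vcvg w : V n w @[n --> \oo] --> W w.
  apply/cvgrPdist_le => e e0; near=> n.
  rewrite distrC (le_trans (VW n w))//.
  rewrite -[e]invrK lef_pV2 ?posrE ?invr_gt0//.
  by near: n; exists (Num.truncn e^-1) => // m /= cm; rewrite ltW// -truncn_le_nat.
have mV n : measurable_fun setT (V n).
  apply: measurable_funM => //; apply: measurable_sum => j.
  exact/measurable_indic/Gm.
have V2 n w : `|V n w| <= 2.
  rewrite -[V n w](subrK (W w)) (le_trans (ler_normD _ _))//.
  have /andP[w0 w1] := W01 w.
  rewrite (_ : 2 = 1 + 1) ?lerD//; last by rewrite ger0_norm.
  by rewrite (le_trans (VW n w))// invf_le1 ?ltr0n// ler1n.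
have VYcvg f : P.-integrable setT (EFin \o f) ->
    \int[P]_w (V n w * f w) @[n --> \oo] --> \int[P]_w (W w * f w).
  move=> fi.
  have fm : measurable_fun setT f by apply/measurable_EFinP/measurable_int/fi.
  apply: (@Rintegral_cvg _ _ _ _ _ _ _ (fun w => 2 * `|f w|)) => //.
  - by move=> n; exact: measurable_funM.
  - by move=> w _; exact: cvgMr_tmp.
  - have := integrableZl measurableT 2 (integrable_norm fi).
    by [].
  - by move=> n w _; rewrite normrM ler_wpM2r.
have Vint f n : P.-integrable setT (EFin \o f) ->
    \int[P]_w (V n w * f w) = n.+1%:R^-1 * \sum_(j < n.+1) \int[P]_(w in A n j) f w.
  move=> fi.
  have fAi j : P.-integrable setT (EFin \o (fun w => \1_(A n j) w * f w)).
    apply: (@bounded_mul_integrable _ 1) => //; first exact/measurable_indic/Gm.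
    by move=> w; rewrite indicE; case: (_ \in _); rewrite ?normr1 ?normr0.
  under eq_Rintegral do rewrite /V -mulrA mulr_suml.
  rewrite RintegralZl//; last first.
    rewrite (_ : _ \o _ = (fun w => \sum_(j < n.+1) (\1_(A n j) w * f w)%:E)%E).
      by apply: integrable_sum => // j _; exact: fAi.
    by apply/funext => x /=; rewrite sumEFin.
  rewrite Rintegral_sum//; congr (_ * _); apply: eq_bigr => j _.
  by rewrite Rintegral_indicM.
rewrite -(cvg_lim (@Rhausdorff R) (VYcvg Y Yi)) -(cvg_lim (@Rhausdorff R) (VYcvg Z Zi)).
congr (limn _); apply/funext => n; rewrite !Vint//; congr (_ * _).
apply: eq_bigr => j _.
exact: is_cond_exp_Rintegral YZ (GA n j).
Unshelve. all: by end_near. Qed.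

Lemma is_cond_expD G Y1 Z1 Y2 Z2 : <<s G >> `<=` measurable ->
  is_cond_exp P <<s G >> Y1 Z1 -> is_cond_exp P <<s G >> Y2 Z2 ->
  is_cond_exp P <<s G >> (fun w => Y1 w + Y2 w) (fun w => Z1 w + Z2 w).
Proof.
move=> Gm [Y1i Z1i mZ1 h1] [Y2i Z2i mZ2 h2]; split.
- exact: (integrableD measurableT Y1i Y2i).
- exact: (integrableD measurableT Z1i Z2i).
- exact: smeasurableD.
- move=> A GA; have mA := Gm _ GA.
  under eq_integral do rewrite EFinD.
  under [RHS]eq_integral do rewrite EFinD.
  rewrite !integralD//=; try exact: (@integrableS _ _ _ _ setT).
  by rewrite h1// h2.
Qed.

Lemma is_cond_expZ G r Y Z : <<s G >> `<=` measurable ->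
  is_cond_exp P <<s G >> Y Z ->
  is_cond_exp P <<s G >> (fun w => r * Y w) (fun w => r * Z w).
Proof.
move=> Gm [Yi Zi mZ h]; split.
- exact: (integrableZl measurableT r Yi).
- exact: (integrableZl measurableT r Zi).
- by apply: smeasurableM => //; exact: smeasurable_cst.
- move=> A GA; have mA := Gm _ GA.
  under eq_integral do rewrite EFinM.
  under [RHS]eq_integral do rewrite EFinM.
  rewrite !integralZl//=; try exact: (@integrableS _ _ _ _ setT).
  by rewrite h.
Qed.

Lemma is_cond_exp_sum G I (s : seq I) (Y Z : I -> T -> R) :
  <<s G >> `<=` measurable ->
  (forall i, is_cond_exp P <<s G >> (Y i) (Z i)) ->
  is_cond_exp P <<s G >> (fun w => \sum_(i <- s) Y i w) (fun w => \sum_(i <- s) Z i w).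
Proof.
move=> Gm YZ; elim: s => [|i s IH].
  rewrite (_ : (fun _ => _) = cst 0); last by apply/funext => w; rewrite big_nil.
  rewrite (_ : (fun w => \sum_(_ <- _) Z _ _) = cst 0); last first.
    by apply/funext => w; rewrite big_nil.
  by split => //; [exact: finite_measure_integrable_cst..|exact: smeasurable_cst].
have := is_cond_expD Gm (YZ i) IH.
by congr is_cond_exp; apply/funext => w; rewrite big_cons.
Qed.

End cond_exp.

(** * Riemann sums of right-continuous functions *)

Section riemann_sums.
Context (R : realType).
Notation leb := (@lebesgue_measure R).
Implicit Types (f : R -> R) (a b x y : R).

Definition grid a b n l : R := a + l%:R * ((b - a) / n.+1%:R).

Lemma grid0 a b n : grid a b n 0 = a.
Proof. by rewrite /grid mul0r addr0. Qed.

Lemma grid_last a b n : grid a b n n.+1 = b.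
Proof. by rewrite /grid mulrC divfK ?pnatr_eq0// addrC subrK. Qed.

Lemma gridS a b n l :
  grid a b n l.+1 = grid a b n l + (b - a) / n.+1%:R.
Proof. by rewrite /grid -natr1 mulrDl mul1r addrA. Qed.

Lemma ler_grid a b n l m : a <= b -> (l <= m)%N ->
  grid a b n l <= grid a b n m.
Proof.
move=> ab lm; rewrite lerD2l ler_wpM2r ?ler_nat//.
by rewrite divr_ge0 ?subr_ge0.
Qed.

(* Taking the values of [f] at right end points makes right continuity of [f]
   sufficient for pointwise convergence. *)
Definition step_fun f a b n x : R :=
  \sum_(l < n.+1) f (grid a b n l.+1) *
    \1_(`]grid a b n l, grid a b n l.+1]%classic) x.

(** The witness [y] is the right end point of the cell containing [x], found as the least grid point
    not below [x]. Its index is positive because [a < x]. *)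
Lemma step_funE f a b n x : a < x <= b -> exists y,
  [/\ step_fun f a b n x = f y, x <= y, y <= b & y <= x + (b - a) / n.+1%:R].
Proof.
move=> /andP[ax xb]; have ab : a <= b by rewrite (le_trans (ltW ax)).
have exm : exists m, x <= grid a b n m.
  by exists n.+1; rewrite grid_last.
case: (ex_minnP exm) => -[|l]; first by rewrite grid0 leNgt ax.
move=> xl minl.
have ln : (l < n.+1)%N by apply: minl; rewrite grid_last.
have lx : grid a b n l < x.
  by rewrite ltNge; apply/negP => /minl; rewrite ltnn.
exists (grid a b n l.+1); split => //.
- rewrite /step_fun (bigD1 (Ordinal ln))//= [X in _ + X]big1 ?addr0.
    by rewrite indicE mem_set ?mulr1//= in_itv/= lx xl.
  move=> k kl; rewrite indicE memNset ?mulr0//= in_itv/= => /andP[kx xk].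
  move/negP: kl; apply; apply/eqP/val_inj/eqP => /=.
  rewrite eqn_leq; apply/andP; split.
  + rewrite leqNgt; apply/negP => lk.
    by have := lt_le_trans kx (le_trans xl (ler_grid n ab lk)); rewrite ltxx.
  + rewrite leqNgt; apply/negP => kl'.
    by have := lt_le_trans lx (le_trans xk (ler_grid n ab kl')); rewrite ltxx.
- by rewrite -[leRHS](grid_last a b n) ler_grid.
- by rewrite gridS lerD2r ltW.
Qed.

Lemma step_fun_cvg f a b x : a < x <= b -> f y @[y --> x^'+] --> f x ->
  step_fun f a b n x @[n --> \oo] --> f x.
Proof.
move=> axb fx; apply/cvgrPdist_lt => e e0.
have /cvgrPdist_lt /(_ e e0) := fx; rewrite near_withinE => -[r /= r0 fr].
near=> n.
have [y [-> xy _ yx]] := step_funE f n axb.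
(* The filter [x^'+] excludes [x] itself, so the case where [x] is a grid point is treated apart. *)
move: xy; rewrite le_eqVlt => /predU1P[<-|xy]; first by rewrite subrr normr0.
apply: fr => //=; rewrite distrC gtr0_norm ?subr_gt0//.
rewrite ltrBlDl (le_lt_trans yx)// ltrD2l.
near: n; exists (Num.truncn ((b - a) / r)) => // m /= bm.
by rewrite ltr_pdivrMr// mulrC -ltr_pdivrMr// -truncn_le_nat.
Unshelve. all: by end_near. Qed.

Lemma measurable_step_fun (D : set R) f a b n :
  measurable_fun D (step_fun f a b n).
Proof.
by apply: measurable_sum => l; apply: measurable_funM.
Qed.

Lemma Rintegral_step_fun f a b n : a <= b ->
  \int[leb]_(x in `]a, b]) step_fun f a b n x =
  \sum_(l < n.+1) f (grid a b n l.+1) * ((b - a) / n.+1%:R).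
Proof.
move=> ab; pose I l := `]grid a b n l, grid a b n l.+1]%classic.
have indI l : leb.-integrable `]a, b] (EFin \o (\1_(I l) : R -> R)).
  apply: (@integrableS _ _ _ _ setT) => //; exact: integrable_indic_itv.
rewrite Rintegral_sum//=; last first.
  move=> l; apply: (integrableZl _ (f (grid a b n l.+1)) (indI l)).
  exact: measurable_itv.
apply: eq_bigr => l _; rewrite RintegralZl; [|exact: measurable_itv|exact: indI].
congr (_ * _).
rewrite /Rintegral integral_indic//= setIidl; last first.
  move=> x; rewrite /= !in_itv/= => /andP[lx xl]; apply/andP; split.
    by rewrite (le_lt_trans _ lx)// -[leLHS](grid0 a b n) ler_grid.
  by rewrite (le_trans xl)// -[leRHS](grid_last a b n) ler_grid.
rewrite lebesgue_measure_itv/= lte_fin gridS.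
case: ifPn => [_|]; first by rewrite -EFinD/= addrAC subrr add0r.
rewrite ltrDl -leNgt => h; apply/esym/eqP; rewrite eq_le h.
by rewrite divr_ge0// subr_ge0.
Qed.

Lemma right_continuous_integrable f a b (M : R) :
  (forall x, a <= x <= b -> `|f x| <= M) ->
  (forall x, a <= x -> f y @[y --> x^'+] --> f x) ->
  leb.-integrable `[a, b] (EFin \o f).
Proof.
move=> fM fr.
have mf : measurable_fun `[a, b] f.
  (* The step functions converge on []a, b]] only; adding the single point [a] preserves
     measurability. *)
  apply: (@measurable_fun_itv_cc _ a b false false).
  apply: (@measurable_fun_cvg _ _ _ _ (step_fun f a b)) => [n|x].
    exact: measurable_step_fun.
  rewrite /= in_itv/= => axb; apply: step_fun_cvg => //.
  by apply: fr; case/andP: axb => /ltW.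
apply: measurable_bounded_integrable => //.
  by rewrite /= lebesgue_measure_itv/=; case: ifP => _; rewrite -?EFinD ltry.
exists M; split; first exact: num_real.
by move=> x Mx y; rewrite /= in_itv/= => aby; apply: le_trans (fM y aby) (ltW Mx).
Qed.

(** The sum is the integral of [step_fun], whose values on []a, b]] are values of [f] at points of
    [[a, b]]. Hence [M] dominates, and right continuity gives pointwise convergence. *)
Lemma riemann_sum_cvg f a b (M : R) : a <= b ->
  (forall x, a <= x <= b -> `|f x| <= M) ->
  (forall x, a <= x -> f y @[y --> x^'+] --> f x) ->
  \sum_(l < n.+1) f (grid a b n l.+1) * ((b - a) / n.+1%:R) @[n --> \oo]
    --> \int[leb]_(x in `]a, b]) f x.
Proof.
move=> ab fM fr; under eq_cvg do rewrite -Rintegral_step_fun//.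
apply: (@Rintegral_cvg _ _ _ _ _ _ _ (cst M)) => //.
- by move=> n; exact: measurable_step_fun.
- move=> x; rewrite /= in_itv/= => axb; apply: step_fun_cvg => //.
  by apply: fr; case/andP: axb => /ltW.
- apply: measurable_bounded_integrable => //.
    by rewrite /= lebesgue_measure_itv/=; case: ifP => _; rewrite -?EFinD ltry.
  exists `|M|; split; first exact: num_real.
  by move=> x Mx y _; exact: ltW.
- move=> n x; rewrite /= in_itv/= => axb.
  have [y [-> xy yb _]] := step_funE f n axb.
  by apply: fM; rewrite yb (le_trans _ xy)//; case/andP: axb => /ltW.
Qed.

End riemann_sums.

(** * The Feynman-Kac formula for Markov chains *)

Section generated_filtrations.
Context disp (T : measurableType disp) (R : realType).

Lemma smeasurable_preimages I (J : set I) (f : I -> T -> R) i : J i ->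
  smeasurable <<s preimages J f >> (f i).
Proof.
move=> Ji B mB; apply: sub_gen_smallest; exists i => //.
by exists B => //; rewrite setTI.
Qed.

Lemma preimages_measurable I (J : set I) (f : I -> T -> R) :
  (forall i, J i -> measurable_fun setT (f i)) ->
  <<s preimages J f >> `<=` measurable.
Proof.
move=> mf; apply: smallest_sub; first exact: sigma_algebra_measurable.
by move=> _ [i Ji [B mB <-]]; exact: mf.
Qed.

Lemma preimagesS I (J K : set I) (f : I -> T -> R) : J `<=` K ->
  preimages J f `<=` preimages K f.
Proof. by move=> JK A [i Ji h]; exists i => //; exact: JK. Qed.

End generated_filtrations.

Lemma expR_slope (R : realType) (c : R) :
  h^-1 * (expR (c * h) - 1) @[h --> 0^'+] --> c.
Proof.
have dc : is_derive (0 : R) 1 ( *%R c) c.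
  by have := is_deriveZ c (is_derive_id (0 : R) 1); rewrite /GRing.scale/= mulr1.
have [] := is_derive1_comp (is_derive_expR (c * 0)) dc.
rewrite mulr0 expR0 mul1r => dv de; apply: cvg_dnbhs_at_right.
move: dv; rewrite /derivable => /cvg_ex[l hl].
move: de; rewrite /derive (cvg_lim _ hl)// => lc.
move: hl; rewrite lc; apply: cvg_trans; apply: near_eq_cvg; apply: nearW => h /=.
by rewrite addr0 mulr0 expR0 /GRing.scale/= mulr1.
Qed.

Section markov_chains.
Context disp (T : measurableType disp) (R : realType) (P : probability T R).
Context (d : nat) (X : R -> T -> 'cV[R]_d) (Q : 'M[R]_d) (lambda : 'cV[R]_d).
Hypothesis lambda_ge0 : forall i, 0 <= lambda i 0.
Hypothesis hX : markov_chain P X Q.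
Implicit Types (r s t : R) (w : T) (W : T -> R).

Definition hazard r w : R := (lambda^T *m X r w) 0 0.

Lemma hazardE r w : hazard r w = \sum_j lambda j 0 * X r w j 0.
Proof. by rewrite /hazard mxE; apply: eq_bigr => j _; rewrite mxE. Qed.

Lemma state_ge0_le1 r w i : 0 <= r -> 0 <= X r w i 0 <= 1.
Proof.
have [h _ _ _ _] := hX; move=> /(h r w) [j ->].
by rewrite mxE eqxx andbT; case: (i == j) => /=; rewrite ?lexx ler01.
Qed.

(** If [X r w] is the basis vector [e_i], the hazard is [lambda i 0]; otherwise the [i]-th
    coordinate vanishes on both sides. Scalar killing thereby becomes multiplication by a diagonal
    matrix. *)
Lemma hazard_state (g : R -> R) r w i : 0 <= r ->
  g (hazard r w) * X r w i 0 = g (lambda i 0) * X r w i 0.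
Proof.
have [h _ _ _ _] := hX; move=> /(h r w) [j Xj].
rewrite hazardE Xj mxE eqxx andbT.
have [->|ij] := eqVneq i j; last by rewrite !mulr0.
rewrite (bigD1 j)//= mxE !eqxx /= big1 ?addr0 ?mulr1// => k kj.
by rewrite mxE (negPf kj) mulr0.
Qed.

Lemma hazard_ge0 r w : 0 <= r -> 0 <= hazard r w.
Proof.
move=> r0; rewrite hazardE sumr_ge0// => j _; rewrite mulr_ge0//.
by have /andP[] := state_ge0_le1 w j r0.
Qed.

Lemma hazard_le r w : 0 <= r -> `|hazard r w| <= \sum_j lambda j 0.
Proof.
move=> r0; rewrite ger0_norm ?hazard_ge0// hazardE ler_sum// => j _.
by rewrite ler_piMr//; have /andP[] := state_ge0_le1 w j r0.
Qed.

Lemma hazard_right_continuous r w : 0 <= r ->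
  hazard y w @[y --> r^'+] --> hazard r w.
Proof.
have [_ _ h _ _] := hX => r0.
rewrite (_ : (fun y => _) = fun y => \sum_j lambda j 0 * X y w j 0); last first.
  by apply/funext => y; rewrite hazardE.
rewrite hazardE; apply: cvg_big => [|j _]; first exact: add_continuous.
apply: cvgMl_tmp.
exact: (cvg_comp _ _ (h r w r0) (@coord_continuous _ _ _ j 0 (X r w))).
Qed.

Lemma smeasurable_state r s i : 0 <= r <= s ->
  smeasurable (filtrationX X s) (fun w => X r w i 0).
Proof.
move=> rs; apply: (@smeasurable_preimages _ _ _ _ _
  (fun ri w => X ri.1 w ri.2 0) (r, i)).
by rewrite /= in_itv.
Qed.

Lemma filtrationXS s t : s <= t -> filtrationX X s `<=` filtrationX X t.
Proof.
move=> st; apply: sub_sigma_algebra2; apply: preimagesS => -[r i] /=.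
by rewrite !in_itv/= => /andP[-> /le_trans]; exact.
Qed.

Lemma filtrationX_sigmaX s : filtrationX X s `<=` sigmaX X.
Proof.
apply: sub_sigma_algebra2; apply: preimagesS => -[r i] /=.
by rewrite !in_itv/= andbT => /andP[].
Qed.

Lemma sigmaX_measurable : sigmaX X `<=` measurable.
Proof.
have [_ h _ _ _] := hX; apply: preimages_measurable => -[r i] /=.
by rewrite in_itv/= andbT; exact: h.
Qed.

Lemma filtrationX_measurable s : filtrationX X s `<=` measurable.
Proof. exact: subset_trans (@filtrationX_sigmaX s) sigmaX_measurable. Qed.

Lemma smeasurable_hazard r s : 0 <= r <= s ->
  smeasurable (filtrationX X s) (hazard r).
Proof.
move=> rs; rewrite (_ : hazard r = fun w => \sum_j lambda j 0 * X r w j 0).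
  apply: smeasurable_sum => j; apply: smeasurableM; first exact: smeasurable_cst.
  exact: smeasurable_state.
by apply/funext => w; rewrite hazardE.
Qed.

Local Notation Lambda := (cumulative_hazard X lambda).

Lemma hazard_integrable b w :
  lebesgue_measure.-integrable `[0, b] (EFin \o hazard ^~ w).
Proof.
apply: (@right_continuous_integrable _ _ _ _ (\sum_j lambda j 0)).
  by move=> x /andP[x0 _]; exact: hazard_le.
by move=> x; exact: hazard_right_continuous.
Qed.

Lemma cumulative_hazardB a b w : 0 <= a <= b ->
  Lambda b w - Lambda a w = \int[lebesgue_measure]_(r in `]a, b]) hazard r w.
Proof.
move=> /andP[a0 ab]; rewrite /cumulative_hazard -/(hazard _ _).
by rewrite Rintegral_itvB ?bnd_simp//; exact: hazard_integrable.
Qed.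

Lemma cumulative_hazard_le a b w : 0 <= a <= b -> Lambda a w <= Lambda b w.
Proof.
move=> ab; rewrite -subr_ge0 cumulative_hazardB//.
apply: Rintegral_ge0 => r; rewrite /= in_itv/= => /andP[ar _].
by apply: hazard_ge0; move: ab => /andP[/le_trans h _]; apply: h; exact: ltW.
Qed.

(** Negative times occur below as survival thresholds that impose no constraint. *)
Lemma cumulative_hazard_neg a w : a <= 0 -> Lambda a w = 0.
Proof.
rewrite /cumulative_hazard le_eqVlt => /predU1P[->|a0].
  by rewrite set_itv1 Rintegral_set1.
by rewrite set_itv_ge ?Rintegral_set0// bnd_simp -ltNge.
Qed.

Lemma cumulative_hazard_ge0 a w : 0 <= Lambda a w.
Proof.
have [a0|/ltW a0] := leP a 0; first by rewrite cumulative_hazard_neg.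
by rewrite -[leLHS](@cumulative_hazard_neg 0 w)// cumulative_hazard_le// lexx.
Qed.

Lemma cumulative_hazard_cvg a b w : 0 <= a <= b ->
  \sum_(l < n.+1) hazard (grid a b n l.+1) w * ((b - a) / n.+1%:R)
    @[n --> \oo] --> Lambda b w - Lambda a w.
Proof.
move=> /andP[a0 ab]; rewrite cumulative_hazardB ?a0//.
apply: (@riemann_sum_cvg _ (hazard ^~ w) _ _ (\sum_j lambda j 0)) => // x.
  by move=> /andP[ax _]; apply: hazard_le; exact: le_trans ax.
by move=> ax; apply: hazard_right_continuous; exact: le_trans ax.
Qed.

(** The Riemann sums only involve the states at times in [[0, b]], and measurability passes to their
    pointwise limit. No joint measurability in time and outcome is invoked. *)
Lemma smeasurable_cumulative_hazard b s : b <= s ->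
  smeasurable (filtrationX X s) (Lambda b).
Proof.
move=> bs; have [b0|/ltW b0] := leP b 0.
  rewrite (_ : Lambda b = cst 0); first exact: smeasurable_cst.
  by apply/funext => w; rewrite cumulative_hazard_neg.
apply: (@smeasurable_cvg _ _ _ _ (fun n w =>
  \sum_(l < n.+1) hazard (grid 0 b n l.+1) w * ((b - 0) / n.+1%:R))).
  move=> n; apply: smeasurable_sum => l; apply: smeasurableM; last first.
    exact: smeasurable_cst.
  apply: smeasurable_hazard; rewrite -{1}(grid0 0 b n) ler_grid//=.
  apply: le_trans bs; rewrite -[leRHS](grid_last 0 b n).
  exact: ler_grid.
move=> w; have := @cumulative_hazard_cvg 0 b w; rewrite lexx => /(_ b0).
by rewrite (@cumulative_hazard_neg 0 w)// (subr0 (Lambda b w)).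
Qed.

Lemma weighted_state_integrable W r i : measurable_fun setT W ->
  (forall w, 0 <= W w <= 1) -> 0 <= r ->
  P.-integrable setT (EFin \o (fun w => W w * X r w i 0)).
Proof.
have [_ h _ _ _] := hX => mW W01 r0; apply: (@bounded_integrable _ _ _ _ _ _ 1) => //.
  by apply: measurable_funM => //; exact: h.
move=> w _; rewrite normrM !ger0_norm; last 2 first.
- by have /andP[] := state_ge0_le1 w i r0.
- by have /andP[] := W01 w.
have /andP[? ?] := state_ge0_le1 w i r0; have /andP[? ?] := W01 w.
by rewrite mulr_ile1.
Qed.

(** * Discretization of the killed chain and passage to the limit *)

Section feynman_kac.
Variable p : R -> 'M[R]_d.
Hypothesis psg : transition_semigroup p.
Hypothesis pQ : h^-1 *: (p h - 1%:M) @[h --> 0^'+] --> Q.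
Hypothesis pX : forall s h : R, 0 <= s -> 0 <= h ->
  is_cond_exp_vec P (filtrationX X s) (X (s + h)) (fun w => p h *m X s w).
Variable m : nat.

Lemma markov_step W s h i : 0 <= s -> 0 <= h ->
  smeasurable (filtrationX X s) W -> (forall w, 0 <= W w <= 1) ->
  \int[P]_w (W w * X (s + h) w i 0) =
  \sum_j p h i j * \int[P]_w (W w * X s w j 0).
Proof.
move=> s0 h0 mW W01.
have mW' := smeasurable_measurable (@filtrationX_measurable s) mW.
rewrite (cond_exp_weight (@filtrationX_measurable s) (pX s0 h0 i) mW W01).
transitivity (\int[P]_w \sum_j p h i j * (W w * X s w j 0)).
  apply: eq_Rintegral => w _; rewrite mxE mulr_sumr.
  by apply: eq_bigr => j _; rewrite mulrCA.
rewrite Rintegral_sum//.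
  apply: eq_bigr => j _; rewrite RintegralZl//.
  exact: weighted_state_integrable.
move=> j; have := weighted_state_integrable j mW' W01 s0.
exact: (integrableZl measurableT (p h i j)).
Qed.

(** The product of the diagonal matrix of killing factors over a time [h] with [p h]: the chain
    moves first, and killing uses the state of arrival, in accordance with Riemann sums at right end
    points. *)
Definition killed_step (h : R) : 'M[R]_d :=
  \matrix_(i, j) (expR (- (m%:R * lambda i 0) * h) * p h i j).

Lemma killing_ge0_le1 (x : R) : 0 <= x -> 0 <= expR (- x) <= 1.
Proof. by move=> x0; rewrite expR_ge0/= expR_le1 oppr_le0. Qed.

Lemma markov_iter W s h n i : 0 <= s -> 0 <= h ->
  smeasurable (filtrationX X s) W -> (forall w, 0 <= W w <= 1) ->
  \int[P]_w (W w * expR (- (m%:R * \sum_(l < n) hazard (s + l.+1%:R * h) w * h))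
             * X (s + n%:R * h) w i 0) =
  \sum_j (killed_step h ^+ n) i j * \int[P]_w (W w * X s w j 0).
Proof.
move=> s0 h0 mW W01.
have r0 l : 0 <= s + l%:R * h by rewrite addr_ge0// mulr_ge0.
elim: n i => [|n IH] i.
  rewrite (bigD1 i)//= big1 ?addr0 => [|j ji]; last first.
    by rewrite expr0 mxE eq_sym (negPf ji) mul0r.
  rewrite expr0 mxE eqxx mul1r; apply: eq_Rintegral => w _.
  by rewrite big_ord0 mulr0 oppr0 expR0 mulr1 mul0r addr0.
(* [V] collects the discount up to time [s + n h] and is measurable at that time, so it is an
   admissible weight for one more Markov step. *)
pose V w := W w * expR (- (m%:R * \sum_(l < n) hazard (s + l.+1%:R * h) w * h)).
have mV : smeasurable (filtrationX X (s + n%:R * h)) V.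
  apply: smeasurableM.
    by apply: smeasurableS mW; apply: filtrationXS; rewrite lerDl mulr_ge0.
  apply: (smeasurable_comp (h := fun x => expR (- (m%:R * x)))).
    apply: measurableT_comp => //; apply: measurableT_comp => //.
  apply: smeasurable_sum => l; apply: smeasurableM; last exact: smeasurable_cst.
  apply: smeasurable_hazard; rewrite r0/= lerD2l ler_wpM2r// ler_nat.
  exact: ltn_ord.
have V01 w : 0 <= V w <= 1.
  have /andP[a0 a1] := W01 w.
  have /andP[b0 b1] : 0 <=
      expR (- (m%:R * \sum_(l < n) hazard (s + l.+1%:R * h) w * h)) <= 1.
    apply: killing_ge0_le1; rewrite mulr_ge0// sumr_ge0// => l _.
    by rewrite mulr_ge0// hazard_ge0.
  by rewrite /V mulr_ge0//= mulr_ile1.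
have sE : s + n.+1%:R * h = s + n%:R * h + h by rewrite -natr1 mulrDl mul1r addrA.
(* The last discount factor depends on the state at the final grid point. Next to the [i]-th
   coordinate of that state it is the constant given by [hazard_state]. *)
transitivity (expR (- (m%:R * lambda i 0) * h) *
    \int[P]_w (V w * X (s + n%:R * h + h) w i 0)).
  rewrite -RintegralZl//; last first.
    apply: weighted_state_integrable => //; last by rewrite -sE.
    exact: smeasurable_measurable (@filtrationX_measurable _) mV.
  apply: eq_Rintegral => w _; rewrite big_ord_recr/= -sE.
  rewrite mulrDr opprD expRD mulrA -/(V w) -mulrA.
  have /= -> := hazard_state (fun x => expR (- (m%:R * (x * h)))) w i (r0 n.+1).
  by rewrite mulNr -[m%:R * _ * h]mulrA mulrCA.
rewrite markov_step// mulr_sumr exprS.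
transitivity (\sum_k killed_step h i k *
    \sum_j (killed_step h ^+ n) k j * \int[P]_w (W w * X s w j 0)).
  by apply: eq_bigr => k _; rewrite IH mxE mulrA.
under eq_bigr do rewrite mulr_sumr.
rewrite exchange_big/=; apply: eq_bigr => j _.
by rewrite mxE mulr_suml; apply: eq_bigr => k _; rewrite mulrA.
Qed.

Lemma colsum_le_killed_step h : 0 <= h -> colsum_le (killed_step h) 1.
Proof.
have [_ _ p0 p1] := psg; move=> h0 j; rewrite -(p1 h j h0); apply: ler_sum => i _.
have /andP[e0 e1] : 0 <= expR (- (m%:R * lambda i 0) * h) <= 1.
  by rewrite mulNr; apply: killing_ge0_le1; rewrite !mulr_ge0.
by rewrite mxE ger0_norm ?mulr_ge0 ?p0// ler_piMl ?p0.
Qed.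

Lemma killed_step_cvg t i j : 0 <= t ->
  n.+1%:R * (killed_step (t / n.+1%:R) - 1) i j @[n --> \oo] -->
  (t *: killed_intensity Q lambda m) i j.
Proof.
(* For [t = 0] the step sizes vanish and do not approach 0 from the right; both sides are then
   zero. *)
have [p0 _ _ _] := psg; rewrite le_eqVlt => /predU1P[<-|t0].
  rewrite scale0r (_ : (fun n => _) = cst ((0 : 'M[R]_d) i j)); first exact: cvg_cst.
  apply/funext => n; rewrite mul0r !mxE mulr0 expR0 mul1r p0 mxE.
  by rewrite subrr mulr0.
pose c := - (m%:R * lambda i 0).
have u0 : t / n.+1%:R @[n --> \oo] --> 0.
  rewrite -[X in _ --> X](mulr0 t); apply: cvgMl_tmp; exact: cvg_harmonic.
have up n : 0 < t / n.+1%:R :> R by rewrite divr_gt0.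
have atr (f : R -> R) (l : R) : f h @[h --> 0^'+] --> l ->
    f (t / n.+1%:R) @[n --> \oo] --> l.
  by move=> /cvg_at_rightP; apply; split => //; exact: u0.
have e1 : expR (c * h) @[h --> 0^'+] --> (1 : R).
  rewrite -expR0; apply: continuous_cvg; first exact: continuous_expR.
  rewrite -[X in _ --> X](mulr0 c); apply: cvgMl_tmp.
  exact: cvg_at_right_filter.
have pij : h^-1 * (p h i j - (i == j)%:R) @[h --> 0^'+] --> Q i j.
  have := cvg_comp _ _ pQ (@coord_continuous _ _ _ i j Q).
  apply: cvg_trans; apply: near_eq_cvg; apply: nearW => h /=.
  by rewrite !mxE.
(* Product rule at 0: with [c] the negative killing rate and [D] the Kronecker symbol, [e^{ch} p_h -
   D = e^{ch} (p_h - D) + (e^{ch} - 1) D]. *)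
have lim : h^-1 * (killed_step h i j - (i == j)%:R) @[h --> 0^'+] -->
    (1 * Q i j + c * (i == j)%:R : R).
  have hc : h^-1 * (expR (c * h) - 1) * (i == j)%:R @[h --> 0^'+] -->
      (c * (i == j)%:R : R) by apply: cvgMr_tmp; exact: expR_slope.
  have F0 : Filter (0 : R)^'+ by exact: at_right_proper_filter.
  have := cvgD (cvgM e1 pij) hc => /(_ F0 F0); apply: cvg_trans.
  apply: near_eq_cvg; apply: nearW => h /=; rewrite fctE/= mxE -/c.
  by move: (expR _) (p h i j) (h^-1) => a b e; ring.
have -> : (t *: killed_intensity Q lambda m) i j = t * (1 * Q i j + c * (i == j)%:R).
  by rewrite !mxE mul1r /c mulNr -mulrA mulr_natr.
apply: cvg_trans (cvgMl_tmp (a := t) (atr _ _ lim)).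
apply: near_eq_cvg; apply: nearW => n /=.
have -> : (killed_step (t / n.+1%:R) - 1) i j =
    killed_step (t / n.+1%:R) i j - (i == j)%:R by rewrite !mxE.
by rewrite mulrA; congr (_ * _); rewrite invf_div mulrC divfK// gt_eqF.
Qed.

(** One sequence is shown to have both sides as limits: [h1] replaces the Riemann sums by the
    integral under dominated convergence, and [h2] evaluates the discretized expectation by
    [markov_iter] and lets the matrix power tend to the exponential. *)
Lemma feynman_kac W s t i : 0 <= s <= t ->
  smeasurable (filtrationX X s) W -> (forall w, 0 <= W w <= 1) ->
  \int[P]_w (W w * expR (- (m%:R * (Lambda t w - Lambda s w))) * X t w i 0) =
  \sum_j mxexp ((t - s) *: killed_intensity Q lambda m) i j *
         \int[P]_w (W w * X s w j 0).
Proof.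
move=> /andP[s0 st] mW W01.
have [_ mX _ _ _] := hX.
have t0 : 0 <= t := le_trans s0 st.
have mW' := smeasurable_measurable (@filtrationX_measurable s) mW.
pose S n w := \sum_(l < n.+1) hazard (grid s t n l.+1) w * ((t - s) / n.+1%:R).
have S0 n w : 0 <= S n w.
  apply: sumr_ge0 => l _; rewrite mulr_ge0 ?divr_ge0 ?subr_ge0//.
  rewrite hazard_ge0//; apply: le_trans s0 _.
  by rewrite -[leLHS](grid0 s t n) ler_grid.
have h1 : \int[P]_w (W w * expR (- (m%:R * S n w)) * X t w i 0) @[n --> \oo] -->
    \int[P]_w (W w * expR (- (m%:R * (Lambda t w - Lambda s w))) * X t w i 0).
  apply: (@Rintegral_cvg _ _ _ _ _ _ _ (cst 1)) => //.
  - move=> n; apply: measurable_funM; last exact: mX.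
    apply: measurable_funM => //; apply: measurableT_comp => //.
    apply: measurableT_comp => //; apply: measurable_funM => //.
    apply: measurable_sum => l; apply: measurable_funM => //.
    apply: smeasurable_measurable (@filtrationX_measurable t) _.
    apply: smeasurable_hazard; apply/andP; split.
      by apply: le_trans s0 _; rewrite -[leLHS](grid0 s t n) ler_grid.
    by rewrite -[leRHS](grid_last s t n) ler_grid.
  - move=> w _; apply: cvgMr_tmp; apply: cvgMl_tmp.
    apply: continuous_cvg; first exact: continuous_expR.
    apply: cvgN; apply: cvgMl_tmp; apply: cumulative_hazard_cvg.
    by rewrite s0.
  - exact: finite_measure_integrable_cst.
  - move=> n w _; rewrite !normrM.
    have /andP[x0 x1] := state_ge0_le1 w i t0; have /andP[w0 w1] := W01 w.
    have /andP[e0 e1] : 0 <= expR (- (m%:R * S n w)) <= 1.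
      by apply: killing_ge0_le1; rewrite mulr_ge0.
    by rewrite !ger0_norm// mulr_ile1 ?mulr_ge0 ?mulr_ile1.
have h2 : \int[P]_w (W w * expR (- (m%:R * S n w)) * X t w i 0) @[n --> \oo] -->
    \sum_j mxexp ((t - s) *: killed_intensity Q lambda m) i j *
         \int[P]_w (W w * X s w j 0).
  rewrite (_ : (fun n => _) = fun n => \sum_j
      (killed_step ((t - s) / n.+1%:R) ^+ n.+1) i j * \int[P]_w (W w * X s w j 0)).
    apply: cvg_big => [|j _]; first exact: add_continuous.
    apply: cvgMr_tmp.
    apply: (@mxexp_limit _ _ (fun n => killed_step ((t - s) / n.+1%:R))).
      by move=> n; apply: colsum_le_killed_step; rewrite divr_ge0 ?subr_ge0.
    by move=> a b; apply: killed_step_cvg; rewrite subr_ge0.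
  apply/funext => n; rewrite -markov_iter ?divr_ge0 ?subr_ge0//.
  by rewrite -/(grid s t n n.+1) grid_last.
by rewrite -(cvg_lim (@Rhausdorff R) h1) -(cvg_lim (@Rhausdorff R) h2).
Qed.

End feynman_kac.

End markov_chains.

(** * Survival of a set of obligors *)

Lemma indic_forall (T : Type) (R : pzRingType) (I : finType) (b : I -> T -> bool) w :
  \1_[set w | forall i, b i w] w = \prod_i (b i w)%:R :> R.
Proof.
rewrite indicE; have [h|/existsNP[i /negP bi]] := pselect (forall i, b i w).
  by rewrite mem_set//= big1// => i _; rewrite h.
rewrite memNset/=; last by move=> /(_ i); apply/negP.
have : ~~ [forall i, b i w] by apply/forallPn; exists i.
rewrite -(big_andE xpredT) => /negPf e.
by rewrite -(@big_morph _ _ (fun b : bool => b%:R : R) 1 *%R true andb) ?e//;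
  case=> [] []; rewrite /= ?mulr1 ?mulr0.
Qed.

Section pi_systems.
Context disp (T : measurableType disp) (R : realType) (P : probability T R).

Lemma is_cond_exp_cst (G : set_system T) (r : R) :
  is_cond_exp P <<s G >> (cst r) (cst r).
Proof.
by split => //; [exact: finite_measure_integrable_cst..|exact: smeasurable_cst].
Qed.

(** Dynkin's pi-lambda theorem: the sets on which the integrals agree are stable under complements,
    thanks to agreement on the whole space, and under countable disjoint unions. *)
Lemma Rintegral_pi_system (G : set_system T) (Y Z : T -> R) :
  G `<=` measurable -> setI_closed G -> G setT ->
  P.-integrable setT (EFin \o Y) -> P.-integrable setT (EFin \o Z) ->
  (forall A, G A -> \int[P]_(w in A) Y w = \int[P]_(w in A) Z w) ->
  forall A, <<s G >> A -> \int[P]_(w in A) Y w = \int[P]_(w in A) Z w.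
Proof.
move=> Gm GI GT Yi Zi YZ.
have sGm : <<s G >> `<=` measurable.
  by apply: smallest_sub => //; exact: sigma_algebra_measurable.
have setD f A : measurable A -> P.-integrable setT (EFin \o f) ->
    \int[P]_(w in ~` A) f w = \int[P]_w f w - \int[P]_(w in A) f w.
  move=> mA fi; rewrite -(setUv A) Rintegral_setU//.
  - by rewrite addrC addKr.
  - exact: measurableC.
  - by rewrite setUv.
  - exact/disj_setPCl.
apply: (@dynkin_induction _ (g_sigma_algebraType G) G
  (fun A => \int[P]_(w in A) Y w = \int[P]_(w in A) Z w)) => //.
- exact: YZ.
- by move=> A GA h; have mA := sGm _ GA; rewrite !setD// h (YZ _ GT).
- move=> F GF tF h; rewrite /Rintegral; congr fine.
  have mF k : measurable (F k : set T) by apply: sGm; exact: GF.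
  have mU : measurable (\bigcup_k F k : set T) by exact: bigcup_measurable.
  have U f : P.-integrable setT (EFin \o f) ->
      (\int[P]_(w in \bigcup_k F k) (f w)%:E)%E =
      (\sum_(k <oo) (\int[P]_(w in F k) f w)%:E)%E.
    move=> fi; rewrite (integral_bigcup (mu := P) tF)//; last exact: integrableS fi.
    apply: eq_eseriesr => k _; rewrite /Rintegral fineK//.
    by apply: integrable_fin_num => //; exact: integrableS fi.
  by rewrite !U//; apply: eq_eseriesr => k _; rewrite h.
Qed.

End pi_systems.

(** * Survival events and conditioning on the default history *)

Section default_model.
Context disp (T : measurableType disp) (R : realType) (P : probability T R).
Context (d n : nat) (X : R -> T -> 'cV[R]_d) (Q : 'M[R]_d) (lambda : 'cV[R]_d).
Context (tau : 'I_n -> T -> \bar R).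
Hypothesis lambda_ge0 : forall i, 0 <= lambda i 0.
Hypothesis hX : markov_chain P X Q.
Hypothesis htau : default_times P X lambda tau.
Implicit Types (q s t : R) (r : 'I_n -> R) (w : T) (k : 'I_n) (K : {set 'I_n}).

Local Notation Lambda := (cumulative_hazard X lambda).

Definition alive k (q : R) w : bool := (q%:E < tau k w)%E.

(** Each obligor has its own threshold, which makes the family stable under intersection by taking
    maxima. A negative threshold imposes nothing, since default times are nonnegative. *)
Definition alive_set r : set T := [set w | forall k, alive k (r k) w].

Definition survival K q w : R := \prod_(k in K) (alive k q w)%:R.

Definition raise K q r k : R := if k \in K then q else r k.

Lemma alive_setE r w : \1_(alive_set r) w = \prod_k (alive k (r k) w)%:R :> R.
Proof. exact: indic_forall. Qed.

Lemma alive_set_neg r : (forall k, r k < 0) -> alive_set r = setT.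
Proof.
have [_ tau0 _ _] := htau; move=> r0; apply/seteqP; split => // w _ k.
by apply: lt_le_trans (tau0 k w); rewrite lte_fin.
Qed.

(** For an obligor in [K], survival beyond [q] already implies survival beyond [r k <= q], so the
    two constraints merge into one. *)
Lemma alive_set_survival K q r w : (forall k, r k <= q) ->
  \1_(alive_set r) w * survival K q w = \1_(alive_set (raise K q r)) w.
Proof.
move=> rq; rewrite !alive_setE /survival [X in _ * X]big_mkcond -big_split/=.
apply: eq_bigr => k _; rewrite /raise; case: ifP; last by rewrite mulr1.
move=> _; case: (boolP (alive k q w)) => [h|]; last by rewrite mulr0.
suff -> : alive k (r k) w by rewrite mulr1.
by apply: le_lt_trans h; rewrite lee_fin.
Qed.

Lemma alive_setI r r' :
  alive_set r `&` alive_set r' = alive_set (fun k => Num.max (r k) (r' k)).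
Proof.
apply/seteqP; split => [w [h h'] k|w h].
  by rewrite /alive EFin_max gt_max; apply/andP; split; [exact: h|exact: h'].
by split => k; have := h k; rewrite /alive EFin_max gt_max => /andP[].
Qed.

Lemma measurable_alive_set r : measurable (alive_set r).
Proof.
have [mt _ _ _] := htau.
rewrite (_ : alive_set r = \bigcap_(k in [set: 'I_n]) (tau k @^-1` `](r k)%:E, +oo[)).
  apply: fin_bigcap_measurable => // k _; rewrite -[X in measurable X]setTI.
  by apply: mt => //; exact: emeasurable_itv.
apply/seteqP; split => w h k => [_|]; first by rewrite /= in_itv/= andbT; exact: h.
by have := h k I; rewrite /= in_itv/= andbT.
Qed.

Lemma cond_alive k q :
  is_cond_exp P (sigmaX X) \1_[set w | alive k q w] (fun w => expR (- Lambda q w)).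
Proof.
have [_ tau0 _ ht] := htau; have [q0|q0] := leP 0 q; first exact: ht.
rewrite (_ : [set w | _] = setT); last first.
  by apply/seteqP; split => // w _; apply: lt_le_trans (tau0 k w); rewrite lte_fin.
rewrite indicT (_ : (fun w => _) = cst 1); first exact: is_cond_exp_cst.
by apply/funext => w; rewrite cumulative_hazard_neg ?oppr0 ?expR0// ltW.
Qed.

Lemma cond_alive_set r :
  is_cond_exp P (sigmaX X) \1_(alive_set r)
    (fun w => \prod_k expR (- Lambda (r k) w)).
Proof.
have [_ _ ci _] := htau.
apply: (ci (fun k => [set x | (r k)%:E < x]%E) (fun k w => expR (- Lambda (r k) w))).
  move=> k; rewrite (_ : [set x | _] = `](r k)%:E, +oo[%classic).
    exact: emeasurable_itv.
  by apply/seteqP; split => x; rewrite /= in_itv/= andbT.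
by move=> k; exact: cond_alive.
Qed.

(** The conditional probability of [alive_set r] given the whole path of [X], by
    [cond_alive_set]. *)
Definition no_default_prob r w : R := \prod_k expR (- Lambda (r k) w).

Lemma no_default_prob_ge0_le1 r w : 0 <= no_default_prob r w <= 1.
Proof.
have h k : 0 <= expR (- Lambda (r k) w) <= 1.
  by apply: killing_ge0_le1; exact: cumulative_hazard_ge0 hX _ _.
rewrite /no_default_prob prodr_ge0 => [|k _]; last by have /andP[] := h k.
by apply: prodr_ile1 => k _; exact: h.
Qed.

(** Both [B] and the state at time [q] are determined by the path of [X]. Their product is thus a
    weight against which the survival indicator may be replaced by its conditional probability. *)
Lemma Rintegral_survival (B : set T) K q r i : 0 <= q -> (forall k, r k <= q) ->
  sigmaX X B ->
  \int[P]_(w in B `&` alive_set r) (survival K q w * X q w i 0) =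
  \int[P]_w (\1_B w * no_default_prob (raise K q r) w * X q w i 0).
Proof.
move=> q0 rq GB.
pose W w := \1_B w * X q w i 0.
have mW : smeasurable (sigmaX X) W.
  apply: smeasurableM; first exact: smeasurable_indic.
  apply: smeasurableS (@filtrationX_sigmaX _ _ _ _ X q) _.
  by apply: smeasurable_state; rewrite q0/=.
have W01 w : 0 <= W w <= 1.
  have /andP[x0 x1] := state_ge0_le1 hX w i q0.
  by rewrite /W indicE; case: (_ \in _); rewrite ?mul1r ?mul0r ?x0 ?lexx ?ler01.
have WE := cond_exp_weight (sigmaX_measurable hX) (cond_alive_set (raise K q r)) mW W01.
rewrite -[LHS]Rintegral_indicM.
transitivity (\int[P]_w (W w * \1_(alive_set (raise K q r)) w)).
  apply: eq_Rintegral => w _; rewrite indicI/= -(alive_set_survival K w rq) /W.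
  by rewrite -!mulrA; congr (_ * _); rewrite [X in _ = X]mulrC -!mulrA.
by rewrite WE; apply: eq_Rintegral => w _; rewrite /W mulrAC.
Qed.

(** Moving the threshold from [s] to [t] changes exactly the [#|K|] factors indexed by [K], each by
    the same exponential. This is where the multiple [#|K|] of the killing rate comes from. *)
Lemma no_default_probE K s t r w :
  no_default_prob (raise K t r) w =
  no_default_prob (raise K s r) w *
  expR (- (#|K|%:R * (Lambda t w - Lambda s w))).
Proof.
rewrite -mulrN expRM_natl -prodr_const /no_default_prob [X in _ * X]big_mkcond.
rewrite -big_split/=; apply: eq_bigr => k _; rewrite /raise.
by case: ifP => _; rewrite ?mulr1// -expRD opprB addKr.
Qed.

Lemma smeasurable_no_default_prob s r : (forall k, r k <= s) ->
  smeasurable (filtrationX X s) (no_default_prob r).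
Proof.
move=> rs; apply: smeasurable_prod => k.
apply: (smeasurable_comp (h := fun x => expR (- x))).
  by apply: measurableT_comp => //.
exact: smeasurable_cumulative_hazard lambda_ge0 hX _ _ (rs k).
Qed.

Lemma survival_feynman_kac (B : set T) K s t r i : 0 <= s <= t ->
  (forall k, r k <= s) -> filtrationX X s B ->
  \int[P]_(w in B `&` alive_set r) (survival K t w * X t w i 0) =
  \sum_j mxexp ((t - s) *: killed_intensity Q lambda #|K|) i j *
    \int[P]_(w in B `&` alive_set r) (survival K s w * X s w j 0).
Proof.
move=> /andP[s0 st] rs GB; have GB' := filtrationX_sigmaX GB.
have [_ _ _ _ [p [psg pQ pX]]] := hX.
rewrite Rintegral_survival ?(le_trans s0)//; last first.
  by move=> k; rewrite (le_trans (rs k)).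
under [RHS]eq_bigr do rewrite Rintegral_survival//.
(* All thresholds of [raise K s r] are at most [s], so this weight is known at time [s], and the
   Feynman-Kac formula applies with [m = #|K|]. *)
pose W w := \1_B w * no_default_prob (raise K s r) w.
have mW : smeasurable (filtrationX X s) W.
  apply: smeasurableM; first exact: smeasurable_indic.
  by apply: smeasurable_no_default_prob => k; rewrite /raise; case: ifP.
have W01 w : 0 <= W w <= 1.
  have := no_default_prob_ge0_le1 (raise K s r) w.
  by rewrite /W indicE; case: (_ \in _); rewrite ?mul1r ?mul0r ?lexx ?ler01.
rewrite -(feynman_kac lambda_ge0 hX psg pQ pX _ _ _ mW W01) ?s0//.
by apply: eq_Rintegral => w _; rewrite (no_default_probE K s t) mulrA.
Qed.

(** A pi-system whose generated sigma-algebra contains [filtration X tau s], chosen so that each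
    member combines an event of the chain with survival constraints only. *)
Definition history_sets s : set_system T :=
  [set A | exists B r, [/\ filtrationX X s B, forall k, r k <= s &
    A = B `&` alive_set r]].

Lemma history_sets_filtrationX s (A : set T) : 0 <= s ->
  filtrationX X s A -> history_sets s A.
Proof.
move=> s0 GA; exists A, (fun=> -1); split => //.
  by move=> _; rewrite (le_trans _ s0)// oppr_le0.
by rewrite alive_set_neg ?setIT// => _; rewrite oppr_lt0.
Qed.

Lemma history_sets_setI s : setI_closed (history_sets s).
Proof.
move=> _ _ [B [r [GB rs ->]]] [B' [r' [GB' rs' ->]]].
exists (B `&` B'), (fun k => Num.max (r k) (r' k)); split.
- exact: (@measurableI _ (g_sigma_algebraType (preimagesX X `[0, s]))).
- by move=> k; rewrite ge_max rs rs'.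
- by rewrite -alive_setI setIACA.
Qed.

Lemma history_sets_measurable s : history_sets s `<=` measurable.
Proof.
move=> _ [B [r [GB _ ->]]]; apply: measurableI; last exact: measurable_alive_set.
exact: (filtrationX_measurable hX GB).
Qed.

Lemma aliveE k q w : (alive k q w)%:R = 1 - (default_indicator tau k q w)%:R :> R.
Proof.
rewrite /alive /default_indicator ltNge; case: (_ <= _)%E; first by rewrite subrr.
by rewrite subr0.
Qed.

Lemma filtration_history_sets s : 0 <= s ->
  filtration X tau s `<=` <<s history_sets s >>.
Proof.
move=> s0; apply: smallest_sub; first exact: smallest_sigma_algebra.
rewrite subUset; split => A.
  move=> XA; apply: sub_gen_smallest; apply: history_sets_filtrationX => //.
  exact: sub_gen_smallest.
move=> [[q k] /= /andP[q0 qs] [B mB <-]]; rewrite setTI.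
(* With threshold -1 elsewhere, only obligor [k] is constrained, and its default indicator is one
   minus the indicator of [alive_set r]. *)
pose r k' := if k' == k then q else -1.
have -> : (fun w => (default_indicator tau k q w)%:R : R) =
    cst 1 \+ (cst (-1) \* \1_(alive_set r)).
  apply/funext => w; rewrite /= alive_setE (bigD1 k)//= big1 => [|k' kk'].
    by rewrite /r eqxx mulr1 mulN1r aliveE opprB addrC subrK.
  rewrite /r (negPf kk'); have [_ tau0 _ _] := htau.
  by rewrite /alive (lt_le_trans _ (tau0 k' w))// lte_fin oppr_lt0.
have : smeasurable <<s history_sets s >> (\1_(alive_set r) : T -> R).
  apply: smeasurable_indic; apply: sub_gen_smallest; exists setT, r.
  rewrite setTI; split => //.
    exact: (@measurableT _ (g_sigma_algebraType (preimagesX X `[0, s]))).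
  by move=> k'; rewrite /r; case: ifP => // _; rewrite (le_trans _ s0)// oppr_le0.
move=> m1; apply: (smeasurableD (smeasurable_cst 1)
  (smeasurableM (smeasurable_cst (-1)) m1)).
exact: mB.
Qed.

Lemma filtration_measurable s : 0 <= s -> filtration X tau s `<=` measurable.
Proof.
move=> s0; apply: subset_trans (filtration_history_sets s0) _.
apply: smallest_sub; first exact: sigma_algebra_measurable.
exact: history_sets_measurable.
Qed.

Lemma survival_ge0_le1 K q w : 0 <= survival K q w <= 1.
Proof.
rewrite /survival prodr_ge0//=; apply: prodr_ile1 => k _.
by case: alive; rewrite ?lexx ?ler01.
Qed.

Lemma smeasurable_survival K q : 0 <= q ->
  smeasurable (filtration X tau q) (survival K q).
Proof.
move=> q0; rewrite (_ : survival K q = fun w =>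
    \prod_k (if k \in K then 1 - (default_indicator tau k q w)%:R else 1)).
  apply: smeasurable_prod => k; case: (k \in K); last exact: smeasurable_cst.
  rewrite (_ : (fun w => _) = cst 1 \+ (cst (-1) \*
    (fun w => (default_indicator tau k q w)%:R))); last first.
    by apply/funext => w /=; rewrite mulN1r.
  apply: smeasurableD; first exact: smeasurable_cst.
  apply: smeasurableM; first exact: smeasurable_cst.
  apply: smeasurableS (sub_sigma_algebra2 (@subsetUr _ _ _)) _.
  apply: (@smeasurable_preimages _ _ _ _ _
    (fun ri w => (default_indicator tau ri.2 ri.1 w)%:R : R) (q, k)).
  by rewrite /= q0 lexx.
apply/funext => w; rewrite /survival big_mkcond; apply: eq_bigr => k _.
by rewrite aliveE.
Qed.

Lemma survival_state_integrable K q i : 0 <= q ->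
  P.-integrable setT (EFin \o (fun w => survival K q w * X q w i 0)).
Proof.
move=> q0; apply: (weighted_state_integrable hX) => // [|w].
  exact: smeasurable_measurable (filtration_measurable q0) (smeasurable_survival K q0).
exact: survival_ge0_le1.
Qed.

(** On [history_sets] the identity is [survival_feynman_kac]; the pi-system argument extends it to
    all of [filtration X tau s]. *)
Lemma cond_survival_state K s t i : 0 <= s <= t ->
  is_cond_exp P (filtration X tau s)
    (fun w => survival K t w * X t w i 0)
    (fun w => survival K s w *
      (mxexp ((t - s) *: killed_intensity Q lambda #|K|) *m X s w) i 0).
Proof.
move=> /andP[s0 st]; have t0 := le_trans s0 st; set E := mxexp _.
have Ei j : P.-integrable setT
    (EFin \o (fun w => E i j * (survival K s w * X s w j 0))).
  exact: (integrableZl measurableT (E i j) (survival_state_integrable K j s0)).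
have -> : (fun w => survival K s w * (E *m X s w) i 0) =
    fun w => \sum_j E i j * (survival K s w * X s w j 0).
  apply/funext => w; rewrite mxE mulr_sumr; apply: eq_bigr => j _.
  by rewrite mulrCA.
have sEi : P.-integrable setT
    (EFin \o (fun w => \sum_j E i j * (survival K s w * X s w j 0))).
  rewrite (_ : _ \o _ = (fun w => \sum_j (E i j * (survival K s w * X s w j 0))%:E)%E).
    by apply: integrable_sum => // j _; exact: Ei.
  by apply/funext => w /=; rewrite sumEFin.
apply: is_cond_expP => //.
- exact: filtration_measurable.
- exact: survival_state_integrable.
- apply: smeasurable_sum => j; apply: smeasurableM; first exact: smeasurable_cst.
  apply: smeasurableM; first exact: smeasurable_survival.
  apply: smeasurableS (sub_sigma_algebra2 (@subsetUl _ _ _)) _.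
  by apply: smeasurable_state; rewrite s0 lexx.
- move=> A /(filtration_history_sets s0); apply: Rintegral_pi_system A.
  + exact: history_sets_measurable.
  + exact: history_sets_setI.
  + apply: history_sets_filtrationX => //.
    exact: (@measurableT _ (g_sigma_algebraType (preimagesX X `[0, s]))).
  + exact: survival_state_integrable.
  + exact: sEi.
  + move=> A hA; have mA := history_sets_measurable hA.
    rewrite Rintegral_sum//; last by move=> j; exact: integrableS (Ei j).
    move: hA mA => [B [r [GB rs ->]]] mA.
    rewrite (survival_feynman_kac _ _ _ rs GB) ?s0//.
    apply: eq_bigr => j _; rewrite RintegralZl//.
    exact: integrableS (survival_state_integrable K j s0).
Qed.

End default_model.

(** * Expansion of the characteristic function *)

Section complex_conditioning.
Context disp (T : measurableType disp) (R : realType) (P : probability T R).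
Implicit Types G : set_system T.

Lemma Re_sum I (s : seq I) (F : I -> R[i]) :
  complex.Re (\sum_(i <- s) F i) = \sum_(i <- s) complex.Re (F i).
Proof. by rewrite (@big_morph _ _ (@complex.Re R) 0 +%R 0 +%R) => // -[? ?] []. Qed.

Lemma Im_sum I (s : seq I) (F : I -> R[i]) :
  complex.Im (\sum_(i <- s) F i) = \sum_(i <- s) complex.Im (F i).
Proof. by rewrite (@big_morph _ _ (@complex.Im R) 0 +%R 0 +%R) => // -[? ?] []. Qed.

Lemma is_cond_expC_sum G I (s : seq I) (Y Z : I -> T -> R[i]) :
  <<s G >> `<=` measurable ->
  (forall i, is_cond_expC P <<s G >> (Y i) (Z i)) ->
  is_cond_expC P <<s G >> (fun w => \sum_(i <- s) Y i w)
                          (fun w => \sum_(i <- s) Z i w).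
Proof.
move=> Gm YZ; split.
- under eq_fun do rewrite Re_sum.
  under [X in is_cond_exp _ _ _ X]eq_fun do rewrite Re_sum.
  by apply: is_cond_exp_sum => // i; case: (YZ i).
- under eq_fun do rewrite Im_sum.
  under [X in is_cond_exp _ _ _ X]eq_fun do rewrite Im_sum.
  by apply: is_cond_exp_sum => // i; case: (YZ i).
Qed.

Lemma is_cond_expC_scale G (c : R[i]) (Y Z : T -> R) :
  <<s G >> `<=` measurable -> is_cond_exp P <<s G >> Y Z ->
  is_cond_expC P <<s G >> (fun w => c * real_complex R (Y w))
                          (fun w => c * real_complex R (Z w)).
Proof.
case: c => a b Gm YZ; split => /=.
- under eq_fun do rewrite mulr0 subr0.
  under [X in is_cond_exp _ _ _ X]eq_fun do rewrite mulr0 subr0.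
  exact: is_cond_expZ.
- under eq_fun do rewrite mulr0 add0r.
  under [X in is_cond_exp _ _ _ X]eq_fun do rewrite mulr0 add0r.
  exact: is_cond_expZ.
Qed.

End complex_conditioning.

Lemma expi_natM (R : realType) (u : R) n : expi (u * n%:R) = expi u ^+ n.
Proof.
elim: n => [|n IH]; first by rewrite mulr0 /expi cos0 sin0.
rewrite exprS -IH -natr1 mulrDr mulr1 addrC /expi cosD sinD.
by congr (Complex _ _); rewrite addrC mulrC [X in _ + X]mulrC.
Qed.

(** Subsets are grouped by cardinality. As [n] bounds every cardinality, [inord] truncates
    nothing. *)
Lemma sum_subset_card (T : finType) (V : nmodType) (A : {set T}) n (f : nat -> V) :
  (#|T| <= n)%N ->
  \sum_(J : {set T} | J \subset A) f #|J| = \sum_(m < n.+1) f m *+ 'C(#|A|, m).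
Proof.
move=> Tn; rewrite (partition_big (fun J : {set T} => inord #|J| : 'I_n.+1) xpredT)//=.
apply: eq_bigr => m _.
have cardE (J : {set T}) : (inord #|J| == m) = (#|J| == m).
  by rewrite -val_eqE/= inordK// ltnS (leq_trans (max_card _)).
under eq_bigl do rewrite cardE.
rewrite (eq_bigr (fun=> f m)) => [|J /andP[_ /eqP->]//].
rewrite sumr_const; congr (_ *+ _).
by rewrite -cards_draws; apply: eq_card => J; rewrite [RHS]inE.
Qed.

(** * Number of defaults and sets of survivors *)

Section default_count.
Context disp (T : measurableType disp) (R : realType) (n : nat).
Context (tau : 'I_n -> T -> \bar R).
Implicit Types (q : R) (w : T).

Lemma default_indicatorE k q w :
  default_indicator tau k q w = ~~ alive tau k q w :> nat.
Proof. by rewrite /default_indicator /alive -leNgt. Qed.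

Lemma survivalE K q w :
  survival tau K q w = (K \subset [set k | alive tau k q w]%SET)%:R :> R.
Proof.
rewrite /survival; case: (boolP (_ \subset _)) => [/fintype.subsetP h|/subsetPn[k kK]].
  by rewrite big1// => k /h; rewrite inE => ->.
by rewrite inE => /negPf ka; rewrite (bigD1 k)//= ka mul0r.
Qed.

Lemma card_alive q w :
  #|[set k | alive tau k q w]%SET| = (n - default_count tau q w)%N.
Proof.
rewrite /default_count; under eq_bigr do rewrite default_indicatorE.
rewrite (eq_bigr (fun k => if ~~ alive tau k q w then 1 else 0)%N); last first.
  by move=> k _; case: (~~ _).
rewrite -big_mkcond sum1_card -[X in (X - _)%N](card_ord n).
rewrite -[X in (X - _)%N](cardC [pred k | ~~ alive tau k q w]) addKn.
by apply: eq_card => k; rewrite !inE negbK.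
Qed.

Lemma default_count_le q w : (default_count tau q w <= n)%N.
Proof.
rewrite -[leqRHS]card_ord -sum1_card; apply: leq_sum => k _.
by rewrite default_indicatorE; case: (~~ _).
Qed.

(* [z ^ N = \prod_k (z + (1 - z) 1_{tau_k > q})], expanded over the set [J] of
   factors contributing [(1 - z) 1_{tau_k > q}]. *)
Lemma expX_default_count (z : R[i]) q w :
  z ^+ default_count tau q w =
  \sum_(J : {set 'I_n}) (1 - z) ^+ #|J| * z ^+ (n - #|J|) *
    real_complex R (survival tau J q w).
Proof.
transitivity (\prod_(k < n) ((1 - z) * (alive tau k q w)%:R + z)).
  rewrite /default_count -prodrXr; apply: eq_bigr => k _.
  rewrite default_indicatorE; case: alive; first by rewrite mulr1 subrK.
  by rewrite mulr0 add0r.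
rewrite bigA_distr; apply: eq_bigr => J _.
rewrite (bigID (mem J))/=.
rewrite (eq_bigr (fun k => (1 - z) * (alive tau k q w)%:R)); last by move=> k ->.
rewrite [X in _ * X](eq_bigr (fun=> z)); last by move=> k /negPf->.
rewrite big_split/= !prodr_const mulrAC; congr (_ * _ * _).
  congr (_ ^+ _); rewrite -[X in (X - _)%N](card_ord n) -(cardC J) addKn.
  by apply: eq_card => k; rewrite !inE.
by rewrite /survival rmorph_prod; apply: eq_bigr => k _; rewrite rmorph_nat.
Qed.

(** The survival indicators keep the sets [J] of living obligors, of which there are [n - N] in
    total. Grouping by [j = n - #|J|] counts ['C(n - N, n - j)] sets, and this equals
    ['C(n - N, j - N)] by symmetry. *)
Lemma sum_survival (z : R[i]) q w (f : nat -> R[i]) :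
  \sum_(J : {set 'I_n}) (1 - z) ^+ #|J| * z ^+ (n - #|J|) *
    (real_complex R (survival tau J q w) * f #|J|) =
  \sum_(default_count tau q w <= j < n.+1)
    'C(n - default_count tau q w, j - default_count tau q w)%:R *
    (1 - z) ^+ (n - j) * z ^+ j * f (n - j)%N.
Proof.
set N := default_count tau q w; have Nn : (N <= n)%N := default_count_le q w.
pose g m := (1 - z) ^+ m * z ^+ (n - m) * f m.
transitivity (\sum_(J : {set 'I_n} | J \subset [set k | alive tau k q w]%SET) g #|J|).
  rewrite [RHS]big_mkcond; apply: eq_bigr => J _; rewrite survivalE rmorph_nat.
  by case: ifP => _; rewrite ?mul0r ?mulr0 ?mul1r.
rewrite (@sum_subset_card _ _ _ n) ?card_ord// card_alive -/N.
rewrite (reindex_inj rev_ord_inj)/= -(big_mkord xpredT (fun j =>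
  g (n.+1 - j.+1)%N *+ 'C(n - N, n.+1 - j.+1))).
(* The terms with [j < N] vanish, since no set of [n - j > n - N] living obligors exists. *)
rewrite (@big_cat_nat _ _ _ N)//=; last exact: leqW.
rewrite big_nat big1 ?add0r => [|j /andP[_ jN]]; last first.
  by rewrite subSS bin_small ?mulr0n// ltn_sub2l// (leq_trans jN).
apply: eq_big_nat => j /andP[Nj jn]; rewrite ltnS in jn.
rewrite subSS /g subKn// -mulr_natl !mulrA; congr (_%:R * _ * _ * _).
by rewrite -[LHS]bin_sub ?leq_sub2l// subnAC subKn.
Qed.

End default_count.

(** * Assembly of the two formulas *)

Theorem proposition2p13 (R : realType) (disp : measure_display)
    (T : measurableType disp) (P : probability T R) (d n : nat)
    (X : R -> T -> 'cV[R]_d) (Q : 'M[R]_d) (lambda : 'cV[R]_d)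
    (tau : 'I_n -> T -> \bar R)
    (hQ : intensity_matrix Q) (hirr : irreducible_intensity Q)
    (hlambda : forall i, 0 <= lambda i 0)
    (hX : markov_chain P X Q)
    (htau : default_times P X lambda tau)
    (s t u : R) (hs : 0 <= s) (hst : s <= t) :
  is_cond_expC_vec P (filtration X tau s)
    (fun w => expi (u * (default_count tau t w)%:R) *: cmx (X t w))
    (fun w => \sum_(0 <= k < n.+1) \sum_(k <= j < n.+1)
       ('C(n - k, j - k)%:R * (1 - expi u) ^+ (n - j) * expi (u * j%:R)) *:
       (cmx (mxexp ((t - s) *: killed_intensity Q lambda (n - j))) *m
        cmx (zeta X tau k s w)))
  /\
  is_cond_expC P (filtration X tau s)
    (fun w => expi (u * (default_count tau t w)%:R))
    (fun w => \sum_(0 <= k < n.+1) \sum_(k <= j < n.+1)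
       ('C(n - k, j - k)%:R * (1 - expi u) ^+ (n - j) * expi (u * j%:R)) *
       ((const_mx 1 : 'rV[R[i]]_d) *m
        cmx (mxexp ((t - s) *: killed_intensity Q lambda (n - j))) *m
        cmx (zeta X tau k s w)) 0 0).
Proof.
have Fm : filtration X tau s `<=` measurable.
  exact: (filtration_measurable hX htau hs).
set RHS1 := (X in is_cond_expC_vec _ _ _ X /\ _).
have part1 : is_cond_expC_vec P (filtration X tau s)
    (fun w => expi (u * (default_count tau t w)%:R) *: cmx (X t w)) RHS1.
  move=> i; pose E m := mxexp ((t - s) *: killed_intensity Q lambda m).
  have -> : (fun w => (expi (u * (default_count tau t w)%:R) *: cmx (X t w)) i 0) =
      fun w => \sum_(J : {set 'I_n}) (1 - expi u) ^+ #|J| * expi u ^+ (n - #|J|) *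
        real_complex R (survival tau J t w * X t w i 0).
    apply/funext => w; rewrite !mxE expi_natM expX_default_count mulr_suml.
    by apply: eq_bigr => J _; rewrite rmorphM mulrA.
  (* At each outcome only the term [k = N_s] of the outer sum survives, because [zeta] vanishes for
     the other [k]; [sum_survival] then turns it into the same expansion over sets [J]. *)
  have -> : (fun w => RHS1 w i 0) =
      fun w => \sum_(J : {set 'I_n}) (1 - expi u) ^+ #|J| * expi u ^+ (n - #|J|) *
        real_complex R (survival tau J s w * (E #|J| *m X s w) i 0).
    apply/funext => w; under [RHS]eq_bigr do rewrite rmorphM.
    rewrite (sum_survival tau _ _ _ (fun m => real_complex R ((E m *m X s w) i 0))).
    rewrite /RHS1 summxE (bigD1_seq (default_count tau s w)) ?iota_uniq//=; last first.
      by rewrite mem_index_iota /= ltnS default_count_le.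
    rewrite [X in _ + X]big1 ?addr0 => [|k kN].
      rewrite summxE; apply: eq_bigr => j _; rewrite mxE expi_natM.
      by rewrite /zeta eqxx scale1r /cmx -map_mxM mxE.
    rewrite summxE big1// => j _; rewrite mxE /zeta eq_sym (negPf kN) scale0r.
    by rewrite /cmx -map_mxM mulmx0 map_mx0 mxE mulr0.
  apply: is_cond_expC_sum => // J; apply: is_cond_expC_scale => //.
  by apply: (cond_survival_state hlambda hX htau); rewrite hs.
split => //.
(* The coordinates of the basis vector [X t w] add up to one, so the second formula is the sum of
   the coordinates of the first. *)
have -> : (fun w => expi (u * (default_count tau t w)%:R)) =
    fun w => \sum_i (expi (u * (default_count tau t w)%:R) *: cmx (X t w)) i 0.
  apply/funext => w; have [h _ _ _ _] := hX.
  have [j ->] := h t w (le_trans hs hst).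
  rewrite (bigD1 j)//= big1 ?addr0 => [|i ij]; last first.
    by rewrite !mxE (negPf ij) rmorph0 mulr0.
  by rewrite !mxE !eqxx rmorph1 mulr1.
rewrite [X in is_cond_expC _ _ _ X](_ : _ = fun w => \sum_i RHS1 w i 0).
  exact: is_cond_expC_sum.
apply/funext => w.
transitivity (((const_mx 1 : 'rV[R[i]]_d) *m RHS1 w) 0 0); last first.
  by rewrite mxE; apply: eq_bigr => i _; rewrite mxE mul1r.
rewrite /RHS1 mulmx_sumr summxE; apply: eq_bigr => k _.
rewrite mulmx_sumr summxE; apply: eq_bigr => j _.
by rewrite -scalemxAr -mulmxA [RHS]mxE.
Qed.
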